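(* The Banach algebra $\mathrm{Z}_{\mathbb{Z}_2}\mathrm{L}^1(\mathbb{T})=\{f\in\mathrm{L}^1(\mathbb{T}): f(s^{-1})=f(s)\text{ for a.e. }s\in\mathbb{T}\}$, a closed subalgebra of the convolution algebra $\mathrm{L}^1(\mathbb{T})$, is amenable.
   Context: $\mathbb{T}=\{s\in\mathbb{C}:|s|=1\}$ with normalised Haar measure; $\mathrm{L}^1(\mathbb{T})$ is its convolution algebra. A Banach algebra $\mathfrak{A}$ is amenable if it has a bounded approximate diagonal: a bounded net $(\mu_\alpha)$ in $\mathfrak{A}\hat\otimes\mathfrak{A}$ with $m(\mu_\alpha)a\to a$, $a\,m(\mu_\alpha)\to a$, $a\cdot\mu_\alpha-\mu_\alpha\cdot a\to0$ for all $a$ ($m$ multiplication, $a\cdot(b\otimes c)=ab\otimes c$, $(b\otimes c)\cdot a=b\otimes ca$). *)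

(* Defs.v *)
From HB Require Import structures.
From mathcomp Require Import all_boot all_order all_algebra.
From mathcomp Require Import all_classical all_reals all_analysis.
From mathcomp Require Import complex.
Set Implicit Arguments. Unset Strict Implicit. Unset Printing Implicit Defensive.
Import Order.TTheory GRing.Theory Num.Theory.
Import numFieldNormedType.Exports.
Local Open Scope classical_set_scope.
Local Open Scope ring_scope.

(* The circle group T is parametrised by t in [0,1) via t |-> exp(2 pi i t);
   normalised Haar measure on T becomes Lebesgue measure on [0,1);
   the group law s*s' becomes t + t' (mod 1), s^{-1} becomes -t (mod 1).
   Elements of L^1(T) are represented by functions R -> C (only their values on
   [0,1) matter), identified up to a.e. equality through the L^1 norm. *)

Section ZL1T.
Variable R : realType.

Definition fn := R -> R[i].

Definition frac (x : R) : R := x - (Num.floor x)%:~R.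

Definition I01 : set R := `[0%R, 1%R[.

Definition mu := @lebesgue_measure R.

Definition cmeasurable (f : fn) : Prop :=
  measurable_fun I01 (fun x => complex.Re (f x)) /\ measurable_fun I01 (fun x => complex.Im (f x)).

Definition l1norm (f : fn) : \bar R :=
  (\int[mu]_(x in I01) (Normc.normc (f x))%:E)%E.

Definition L1 (f : fn) : Prop := cmeasurable f /\ (l1norm f < +oo)%E.

Definition inv_symmetric (f : fn) : Prop :=
  {ae mu, forall x, I01 x -> f (frac (- x)) = f x}.

Definition ZL1 (f : fn) : Prop := L1 f /\ inv_symmetric f.

Definition cint (h : R -> R[i]) : R[i] :=
  Complex (Rintegral mu I01 (fun u => complex.Re (h u)))
          (Rintegral mu I01 (fun u => complex.Im (h u))).

Definition conv (f g : fn) : fn := fun t => cint (fun u => f (frac (t - u)) * g u).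

Definition fsub (f g : fn) : fn := fun t => f t - g t.

Section Amenability.
Variables (A : fn -> Prop) (mul : fn -> fn -> fn) (nrm : fn -> \bar R).

(* bounded complex-bilinear forms on A x A of norm <= 1, i.e. the unit ball of
   the dual of the projective tensor product A (x)^ A *)
Definition bil_unit_ball (phi : fn -> fn -> R[i]) : Prop :=
  [/\ (forall (c : R[i]) f1 f2 g, A f1 -> A f2 -> A g ->
          phi (fun t => c * f1 t + f2 t) g = c * phi f1 g + phi f2 g),
      (forall (c : R[i]) f g1 g2, A f -> A g1 -> A g2 ->
          phi f (fun t => c * g1 t + g2 t) = c * phi f g1 + phi f g2) &
      (forall f g, A f -> A g -> ((Normc.normc (phi f g))%:E <= nrm f * nrm g)%E)].

(* an element of A (x)^ A, given by a representation
   sum_n r_n.1 (x) r_n.2 with sum_n ||r_n.1|| ||r_n.2|| < oo *)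
Definition tensor_rep (r : nat -> fn * fn) : Prop :=
  (forall n, A (r n).1 /\ A (r n).2) /\
  exists M : R, forall N, (\sum_(n < N) (nrm (r n).1 * nrm (r n).2) <= M%:E)%E.

Definition csum_to (u : nat -> R[i]) (z : R[i]) : Prop :=
  forall e : R, 0 < e -> exists N0, forall N, (N0 <= N)%N ->
    Normc.normc (z - \sum_(n < N) u n) < e.

Definition pairing (phi : fn -> fn -> R[i]) (r : nat -> fn * fn) (z : R[i]) :=
  csum_to (fun n => phi (r n).1 (r n).2) z.

(* projective norm of (r1 - r2) is <= c  (projective norm computed as the
   norm in the bidual: sup over the unit ball of bounded bilinear forms) *)
Definition pinorm_diff_le (r1 r2 : nat -> fn * fn) (c : R) : Prop :=
  forall phi, bil_unit_ball phi -> forall z1 z2,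
    pairing phi r1 z1 -> pairing phi r2 z2 -> Normc.normc (z1 - z2) <= c.

Definition zero_rep : nat -> fn * fn := fun _ => (fun _ => 0, fun _ => 0).

Definition lact (a : fn) (r : nat -> fn * fn) : nat -> fn * fn :=
  fun n => (mul a (r n).1, (r n).2).
Definition ract (r : nat -> fn * fn) (a : fn) : nat -> fn * fn :=
  fun n => ((r n).1, mul (r n).2 a).

Definition directed (I : Type) (le : I -> I -> Prop) : Prop :=
  [/\ inhabited I, (forall i, le i i),
      (forall i j k, le i j -> le j k -> le i k) &
      (forall i j, exists k, le i k /\ le j k)].

Definition eventually (I : Type) (le : I -> I -> Prop) (P : I -> Prop) :=
  exists i0, forall i, le i0 i -> P i.

Definition mult_to (r : nat -> fn * fn) (g : fn) : Prop :=
  forall e : R, 0 < e -> exists N0, forall N, (N0 <= N)%N ->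
    (nrm (fun t => (g t - \sum_(n < N) mul (r n).1 (r n).2 t)%R) < e%:E)%E.

(* A is amenable: it has a bounded approximate diagonal *)
Definition amenable : Prop :=
  exists (I : Type) (le : I -> I -> Prop) (mu_ : I -> nat -> fn * fn)
         (m : I -> fn) (K : R),
    [/\ directed le,
        (forall i, tensor_rep (mu_ i)),
        (forall i, pinorm_diff_le (mu_ i) zero_rep K),
        (forall i, A (m i) /\ mult_to (mu_ i) (m i)) &
        forall a, A a -> forall e : R, 0 < e -> eventually le (fun i =>
          [/\ (nrm (fsub (mul (m i) a) a) < e%:E)%E,
              (nrm (fsub (mul a (m i)) a) < e%:E)%E &
              pinorm_diff_le (lact a (mu_ i)) (ract (mu_ i) a) e])].

End Amenability.

Definition ZL1T_amenable : Prop := amenable ZL1 conv l1norm.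

End ZL1T.

(* Main.v *)
Require Import Defs.
From HB Require Import structures.
From mathcomp Require Import all_boot all_order all_algebra.
From mathcomp Require Import all_classical all_reals all_analysis.
From mathcomp Require Import measurable_realfun.
From mathcomp Require Import complex.
From mathcomp Require Import ring lra zify.
Set Implicit Arguments. Unset Strict Implicit. Unset Printing Implicit Defensive.
Import Order.TTheory GRing.Theory Num.Theory.
Import numFieldNormedType.Exports.
Local Open Scope classical_set_scope.
Local Open Scope ring_scope.

(** The even trigonometric functions chi_0 = 1 and chi_n = 2 cos (2 pi n t) are
    orthogonal idempotents of the algebra, and a * chi_n = (a, cos_n) chi_n for
    even a.  Hence, for any coefficients b_n, the tensor sum_n b_n^2 chi_n (x) chi_n
    commutes exactly with the algebra, and its product is sum_n b_n^2 chi_n.  With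
    b_n the Fejer coefficients this product is F_N * F_N, which is an approximate
    identity by Fejer's theorem in L^1.  The tensor stays bounded because the
    diagonal sum_n chi_n (x) chi_n is the measure carried by the diagonal and the
    antidiagonal of the torus minus 1 (x) 1: smoothed by F_N, it is twice an average
    of elementary tensors g (x) g, with g a mean of two translates of F_N, minus
    1 (x) 1, so that its norm is at most 3. *)

(** * Dirichlet and Fejer kernels *)

(** Estimated term by term, the tensor only has a bound that grows linearly with N, so a uniform
    bound must come from rewriting it through elementary tensors of norm one. Positivity supplies
    these: a nonnegative kernel has L^1 norm equal to its mass. Each of the two legs needs its own
    Fejer kernel, and this is why the coefficients appear squared. A single translate of F_N is not
    even and so leaves the algebra, on which alone the bilinear forms are controlled. Averaging over
    s and -s brings it back, at the price of the antidiagonal. The average over s is taken over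
    finitely many roots of unity: on trigonometric polynomials of bounded degree this quadrature is
    exact, and a bilinear form passes through a finite sum by linearity alone. *)

Definition wt (R : realType) (n : nat) : R := if n is 0 then 1 else 2.

Lemma wt_gt0 (R : realType) n : 0 < wt R n.
Proof. by case: n => //= *; rewrite ltr0n. Qed.

Lemma cosMnS (R : realType) (n : nat) (x : R) :
  cos (n.+1%:R * x) = cos (n%:R * x) * cos x - sin (n%:R * x) * sin x.
Proof. by rewrite -cosD -natr1 mulrDl mul1r. Qed.

Lemma sinMnS (R : realType) (n : nat) (x : R) :
  sin (n.+1%:R * x) = sin (n%:R * x) * cos x + cos (n%:R * x) * sin x.
Proof. by rewrite -sinD -natr1 mulrDl mul1r. Qed.

Lemma sinE2 (R : realType) (x : R) : sin x * sin x = 1 - cos x * cos x.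
Proof. by have := cos2Dsin2 x; rewrite !expr2 => <-; rewrite addrC addKr. Qed.

Lemma cos_eq1_sin (R : realType) (x : R) : cos x = 1 -> sin x = 0.
Proof.
move=> cx; have := sinE2 x; rewrite cx mulr1 subrr => /eqP.
by rewrite mulf_eq0 orbb => /eqP.
Qed.

Lemma cos_eq1_cosMn (R : realType) (n : nat) (x : R) : cos x = 1 ->
  cos (n%:R * x) = 1.
Proof.
move=> cx; have sx := cos_eq1_sin cx.
by elim: n => [|n IH]; rewrite ?mul0r ?cos0// cosMnS IH cx sx; ring.
Qed.

(** One of the two truncated differences is zero, so their sum is the distance between n and m. *)
Lemma cosMcos (R : realType) (n m : nat) (x : R) :
  cos (n%:R * x) * cos (m%:R * x) =
  2^-1 * (cos ((n + m)%:R * x) + cos (((n - m) + (m - n))%:R * x)).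
Proof.
wlog nm : n m / (m <= n)%N => [h|].
  have [/h//|/ltnW/h] := leqP m n.
  by rewrite mulrC => ->; rewrite addnC [(_ - _ + _)%N]addnC.
have -> : (m - n = 0)%N by apply/eqP.
by rewrite addn0 natrD natrB // mulrDl mulrBl cosD cosB; field.
Qed.

Lemma cos_lt1 (R : realType) (x : R) : 0 < x < 2 * pi -> cos x < 1.
Proof.
move=> /andP[x0 x2].
have s : 0 < sin (x / 2) by apply: sin_gt0_pi; apply/andP; split; lra.
have -> : x = x / 2 + x / 2 by lra.
by rewrite cosD sinE2; have := sinE2 (x/2); nra.
Qed.

(** The closed form of the Dirichlet kernel, kept multiplied by [1 - cos x] so that it also holds
    where this factor vanishes. *)
Lemma dirichlet_kernelE (R : realType) (N : nat) (x : R) :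
  (1 - cos x) * (\sum_(n < N.+1) wt R n * cos (n%:R * x)) =
  cos (N%:R * x) - cos (N.+1%:R * x).
Proof.
elim: N => [|N IH].
  by rewrite big_ord_recl big_ord0 addr0 /= !mul0r cos0 !mulr1 mul1r.
rewrite big_ord_recr mulrDr IH /=.
have h := sinE2 x.
rewrite (cosMnS N.+1) (sinMnS N) !(cosMnS N).
ring: h.
Qed.

(** The weighted sum is the sum of the first N Dirichlet kernels, whose closed forms telescope. *)
Lemma fejer_kernelE (R : realType) (N : nat) (x : R) :
  (1 - cos x) * (\sum_(n < N) (N - n)%:R * (wt R n * cos (n%:R * x))) =
  1 - cos (N%:R * x).
Proof.
elim: N => [|N IH]; first by rewrite big_ord0 mulr0 mul0r cos0 subrr.
have -> : \sum_(n < N.+1) (N.+1 - n)%:R * (wt R n * cos (n%:R * x)) =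
   \sum_(n < N) (N - n)%:R * (wt R n * cos (n%:R * x)) +
   \sum_(n < N.+1) wt R n * cos (n%:R * x).
  have -> : \sum_(n < N) (N - n)%:R * (wt R n * cos (n%:R * x)) =
      \sum_(n < N.+1) (N - n)%:R * (wt R n * cos (n%:R * x)).
    by rewrite big_ord_recr /= subnn mul0r addr0.
  rewrite -big_split /=; apply: eq_bigr => i _.
  by rewrite subSn ?(leq_ord i)// -natr1 mulrDl mul1r.
by rewrite mulrDr IH dirichlet_kernelE addrA subrK.
Qed.

Lemma fejer_kernel_ge0 (R : realType) (N : nat) (x : R) :
  0 <= \sum_(n < N) (N - n)%:R * (wt R n * cos (n%:R * x)).
Proof.
(* At the zeros of [1 - cos x] the closed form is void, but there every cosine in the sum equals
   1. *)
have [cx|cx] := eqVneq (cos x) 1.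
  apply: sumr_ge0 => i _; rewrite cos_eq1_cosMn// mulr1.
  by rewrite mulr_ge0// ltW// wt_gt0.
have c1 : 0 < 1 - cos x by rewrite subr_gt0 lt_neqAle cx cos_le1.
by rewrite -(pmulr_rge0 _ c1) fejer_kernelE subr_ge0 cos_le1.
Qed.

Lemma cos_2pi (R : realType) : cos (2 * pi) = 1 :> R.
Proof. by have := cos2pi R; rewrite -[pi *+ 2]mulr_natl. Qed.

(** With x = 2 pi k / M, the closed form of the Dirichlet kernel of degree M - 1 gives (1 - cos x) D
    = cos x - 1, because (M - 1) x is -x modulo 2 pi. So D = -1, which makes the plain cosine sum
    vanish. *)
Lemma sum_cos_root_unity (R : realType) (M k : nat) : (0 < k < M)%N ->
  \sum_(j < M) cos (j%:R * (2 * pi * (k%:R / M%:R))) = 0 :> R.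
Proof.
move=> /andP[k0 kM]; have M0 : (0 < M)%N by exact: leq_trans kM.
set x := 2 * pi * (k%:R / M%:R) : R.
have Mx : M%:R * x = k%:R * (2 * pi).
  by rewrite /x; field; rewrite pnatr_eq0 -lt0n.
have cM : cos (M%:R * x) = 1 by rewrite Mx cos_eq1_cosMn // cos_2pi.
have x1 : cos x != 1.
  suff : cos x < 1 by rewrite lt_neqAle => /andP[].
  apply: cos_lt1; have p0 := @pi_gt0 R.
  have ? : (0 : R) < k%:R / M%:R by rewrite divr_gt0 ?ltr0n.
  have ? : k%:R / M%:R < 1 :> R by rewrite ltr_pdivrMr ?ltr0n// mul1r ltr_nat.
  by rewrite /x; apply/andP; split; nra.
case: M => [|M] in M0 kM x Mx cM x1 * => //.
have := dirichlet_kernelE M x.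
have -> : cos (M%:R * x) = cos x.
  have := cosB (M.+1%:R * x) x; rewrite -[M.+1%:R]natr1 mulrDl mul1r addrK => ->.
  have := cos_eq1_sin cM.
  by move: cM; rewrite -[M.+1%:R]natr1 mulrDl mul1r => -> ->; rewrite mul1r mul0r addr0.
rewrite cM big_ord_recl /= mul0r cos0 mulr1.
have -> : \sum_(i < M) wt R (bump 0 i) * cos ((bump 0 i)%:R * x) =
  2 * \sum_(i < M) cos ((bump 0 i)%:R * x).
  by rewrite mulr_sumr; apply: eq_bigr.
rewrite big_ord_recl mul0r cos0; set S := \sum_(i < M) _.
move=> h; have : (1 - cos x) * (1 + S) = 0 by nra.
by move/eqP; rewrite mulf_eq0 subr_eq0 eq_sym (negbTE x1) => /eqP.
Qed.

(** Discrete orthogonality. The condition n + m < M excludes aliasing: neither n + m nor the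
    distance of n and m is a nonzero multiple of M. *)
Lemma sum_cosMcos (R : realType) (M n m : nat) : (n + m < M)%N ->
  \sum_(j < M) cos (n%:R * (2 * pi * (j%:R / M%:R))) * cos (m%:R * (2 * pi * (j%:R / M%:R))) =
  (n == m)%:R * (M%:R / wt R n).
Proof.
move=> nmM.
have sw (j k : nat) : k%:R * (2 * pi * (j%:R / M%:R)) = j%:R * (2 * pi * (k%:R / M%:R)) :> R.
  by ring.
have S k : (k < M)%N -> \sum_(j < M) cos (k%:R * (2 * pi * (j%:R / M%:R))) = (k == 0)%:R * M%:R :> R.
  case: k => [_|k kM].
    under eq_bigr do rewrite mul0r cos0.
    by rewrite sumr_const card_ord mul1r.
  under eq_bigr do rewrite sw.
  by rewrite sum_cos_root_unity // mul0r.
under eq_bigr do rewrite cosMcos.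
rewrite -mulr_sumr big_split /= !S //; last by lia.
rewrite !addn_eq0 !subn_eq0 -eqn_leq.
have [->|nm] := eqVneq n m; first by case: m {nmM} => [|m] /=; field.
suff -> : (n == 0) && (m == 0) = false by rewrite !mul0r addr0 mulr0.
by apply: contra_neqF nm => /andP[/eqP -> /eqP ->].
Qed.

(** * Reflections of the circle *)

Lemma measurable_I01 (R : realType) : measurable (@I01 R : set (measurableTypeR R)).
Proof. exact: measurable_itv. Qed.

Lemma lebesgue_I01 (R : realType) : lebesgue_measure (@I01 R) = 1%:E.
Proof. by rewrite lebesgue_measure_itv /= lte01 oppr0 adde0. Qed.

Lemma I01_sub (R : realType) : @I01 R `<=` `[0, 1].
Proof. by move=> x; rewrite /I01 /= !in_itv /= => /andP[-> /ltW ->]. Qed.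

Lemma continuous_bounded01 (R : realType) (g : R -> R) : continuous g ->
  exists2 M : R, 0 <= M & forall u, @I01 R u -> `|g u| <= M.
Proof.
move=> cg.
have := @continuous_compact _ _ g `[0%R, 1%R] (continuous_subspaceT cg) (@segment_compact R 0 1).
move/compact_bounded; case=> M [Mr hM]; exists (Num.max 0 (M + 1)); first by rewrite le_max lexx.
move=> u Iu; rewrite le_max; apply/orP; right; apply: hM; first by rewrite ltrDl.
by exists u => //; exact: I01_sub.
Qed.

Lemma continuous_integrable01 (R : realType) (g : R -> R) : continuous g ->
  lebesgue_measure.-integrable (@I01 R) (EFin \o g).
Proof.
move=> cg.
have h : lebesgue_measure.-integrable `[0%R, 1%R] (EFin \o g).
  apply: continuous_compact_integrable; first exact: segment_compact.
  exact: continuous_subspaceT.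
apply: integrableS h => //.
  exact: measurable_I01.
exact: I01_sub.
Qed.

Lemma integrable01_mull (R : realType) (g h : R -> R) : continuous g ->
  lebesgue_measure.-integrable (@I01 R) (EFin \o h) ->
  lebesgue_measure.-integrable (@I01 R) (EFin \o (fun u => g u * h u)).
Proof.
move=> cg ih.
have -> : EFin \o (fun u => g u * h u) = ((EFin \o g) \* (EFin \o h))%E.
  by apply/funext => u /=; rewrite EFinM.
apply: integrableMr => //.
- exact: measurable_I01.
- apply: measurable_funTS; exact: continuous_measurable_fun.
- have [M _ hM] := continuous_bounded01 cg.
  exists M; split; first exact: num_real.
  by move=> x Mx y /= /hM /le_trans; apply; exact: ltW.
Qed.

Lemma integrable01_Zl (R : realType) (c : R) (h : R -> R) :
  lebesgue_measure.-integrable (@I01 R) (EFin \o h) ->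
  lebesgue_measure.-integrable (@I01 R) (EFin \o (fun u => c * h u)).
Proof. by apply: (@integrable01_mull _ (fun=> c)) => //; exact: cst_continuous. Qed.

Lemma Rintegral_cst01 (R : realType) (r : R) :
  \int[lebesgue_measure]_(u in @I01 R) r = r.
Proof.
rewrite Rintegral_cst; last exact: measurable_I01.
have /(congr1 fine) /= m1 := lebesgue_I01 R.
by rewrite -[RHS]mulr1; congr (_ * _).
Qed.

Lemma measurable_reflection (R : realType) (c : R) :
  measurable_fun setT ((fun u => c - u) : measurableTypeR R -> measurableTypeR R).
Proof. by apply: measurable_funB. Qed.

Lemma lebesgue_measure_reflection (R : realType) (c : R) (A : set R) : measurable A ->
  pushforward lebesgue_measure ((fun u => c - u) : _ -> measurableTypeR R) A = lebesgue_measure A.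
Proof.
have mphi := measurable_reflection c.
move=> mA; apply/esym/lebesgue_measure_unique => //= _ [[a b]] _ <-.
rewrite /pushforward.
have -> : ((fun u => c - u) : measurableTypeR R -> measurableTypeR R) @^-1` `]a, b] = `[c - b, c - a[%classic.
  apply/seteqP; split => x /=; rewrite !in_itv /=.
    by move=> /andP[? ?]; apply/andP; split; lra.
  by move=> /andP[? ?]; apply/andP; split; lra.
rewrite !lebesgue_measure_itv/= !lte_fin ltrD2l ltrN2 -!EFinD.
by case: ifP => // _; congr EFin; lra.
Qed.

Lemma ge0_integral_reflection (R : realType) (c : R) (D : set R) (f : R -> \bar R) :
  measurable D -> (fun u => c - u) @^-1` D = D ->
  measurable_fun D f -> (forall y, D y -> (0 <= f y)%E) ->
  (\int[lebesgue_measure]_(u in D) f (c - u)%R = \int[lebesgue_measure]_(u in D) f u)%E.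
Proof.
move=> mD DE mf f0.
have mphi := measurable_reflection c.
rewrite -{1}DE -(ge0_integral_pushforward mphi lebesgue_measure mD mf); last first.
  by move=> y /set_mem; exact: f0.
by apply: eq_measure_integral => A mA _; exact: lebesgue_measure_reflection.
Qed.

Lemma measurable_fun_reflection (R : realType) d (T : measurableType d) (c : R)
    (D : set R) (f : R -> T) :
  (fun u => c - u) @^-1` D = D -> measurable_fun D f ->
  measurable_fun D (fun u => f (c - u)).
Proof.
move=> DE mf mD B mB.
have mphi : measurable_fun setT ((fun u => c - u) : measurableTypeR R -> measurableTypeR R).
  exact: measurable_reflection.
have := mphi measurableT _ (mf mD _ mB).
rewrite setTI; congr (measurable _); rewrite preimage_setI DE.
by apply/seteqP; split.
Qed.

Lemma integrable_reflection (R : realType) (c : R) (D : set R) (f : R -> R) :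
  measurable D -> (fun u => c - u) @^-1` D = D ->
  lebesgue_measure.-integrable D (EFin \o f) ->
  lebesgue_measure.-integrable D (EFin \o (fun u => f (c - u))).
Proof.
move=> mD DE /integrableP[mf fi]; apply/integrableP; split.
  exact: (measurable_fun_reflection DE mf).
rewrite (@ge0_integral_reflection _ c D (fun u => `|(f u)%:E|)%E) //.
exact: measurableT_comp.
Qed.

Lemma Rintegral_reflection (R : realType) (c : R) (D : set R) (f : R -> R) :
  measurable D -> (fun u => c - u) @^-1` D = D ->
  lebesgue_measure.-integrable D (EFin \o f) ->
  (\int[lebesgue_measure]_(u in D) f (c - u) = \int[lebesgue_measure]_(u in D) f u)%R.
Proof.
move=> mD DE /integrableP[mf fi]; rewrite /Rintegral; congr fine.
rewrite integralE [RHS]integralE; congr (_ - _)%E.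
- rewrite -(ge0_integral_reflection mD DE (measurable_funepos mf)) => [|y _].
    by apply: eq_integral => u _; rewrite ?funeposE.
  exact: funepos_ge0.
- rewrite -(ge0_integral_reflection mD DE (measurable_funeneg mf)) => [|y _].
    by apply: eq_integral => u _; rewrite ?funenegE.
  exact: funeneg_ge0.
Qed.

(** * Invariance of Haar measure on the circle *)

Lemma frac_itv (R : realType) (x : R) : 0 <= Defs.frac x < 1.
Proof.
rewrite /Defs.frac subr_ge0 Num.Theory.floor_le /= ltrBlDl.
by have := floorD1_gt x; rewrite intrD.
Qed.

Lemma fracDz (R : realType) (x : R) (z : int) : Defs.frac (x + z%:~R) = Defs.frac x.
Proof. by rewrite /Defs.frac floorDrz ?intrD ?intr_int // intrKfloor; ring. Qed.

Lemma frac_id (R : realType) (x : R) : 0 <= x < 1 -> Defs.frac x = x.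
Proof.
move=> /andP[x0 x1]; rewrite /Defs.frac.
by rewrite (@floor_def _ x 0) ?subr0 // x0 /= add0r.
Qed.

(** In the chart [0, 1) the map u -> t - u of the circle is a pair of reflections, one of [[0, s]]
    and one of []s, 1[]. The point s belongs to the first piece, where it goes to 0; the second
    formula would send it to 1. *)
Lemma I01_fracB (R : realType) (t : R) : exists s : R, 0 <= s < 1 /\
  (forall u, `[0, s]%classic u -> Defs.frac (t - u) = s - u) /\
  (forall u, `]s, 1[%classic u -> Defs.frac (t - u) = (s + 1) - u).
Proof.
have := frac_itv t; set s := Defs.frac t => /andP[s0 s1]; exists s; split; first by rewrite s0.
have tE : t = s + (Num.floor t)%:~R by rewrite /s /Defs.frac subrK.
split => u /=; rewrite in_itv /= => /andP[u0 u1].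
  rewrite {1}tE addrAC fracDz frac_id //; apply/andP; split; lra.
rewrite {1}tE; have -> : s + (Num.floor t)%:~R - u = (s + 1 - u) + (Num.floor t - 1)%:~R.
  by rewrite intrD intrN; ring.
rewrite fracDz frac_id //; apply/andP; split; lra.
Qed.

Lemma I01_split (R : realType) (s : R) : 0 <= s < 1 -> @I01 R = `[0, s] `|` `]s, 1[.
Proof.
move=> /andP[s0 s1]; apply/seteqP; split => x; rewrite /I01 /= !in_itv /=.
  by move=> /andP[-> ->] /=; rewrite andbT; apply/orP; rewrite leNgt; case: ltP => //; rewrite ?orbT.
by move=> [|] /andP[? ?]; apply/andP; split; lra.
Qed.

Lemma reflection_cc (R : realType) (s : R) : (fun u => s - u) @^-1` `[0, s] = `[0, s]%classic.
Proof. by apply/seteqP; split => x /=; rewrite !in_itv /= => /andP[? ?]; apply/andP; split; lra. Qed.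

Lemma reflection_oo (R : realType) (s : R) : (fun u => s + 1 - u) @^-1` `]s, 1[ = `]s, 1[%classic.
Proof. by apply/seteqP; split => x /=; rewrite !in_itv /= => /andP[? ?]; apply/andP; split; lra. Qed.

Lemma integrable_setU (R : realType) (A B : set R) (f : R -> \bar R) :
  measurable A -> measurable B -> [disjoint A & B] ->
  lebesgue_measure.-integrable A f -> lebesgue_measure.-integrable B f ->
  lebesgue_measure.-integrable (A `|` B) f.
Proof.
move=> mA mB dAB /integrableP[mfA fA] /integrableP[mfB fB].
have mf : measurable_fun (A `|` B) f by apply/measurable_funU.
apply/integrableP; split => //.
rewrite ge0_integral_setU //; last exact: measurableT_comp.
exact: lte_add_pinfty.
Qed.

(** Translation and inversion invariance in one statement: each of the two pieces is mapped to
    itself by a reflection of the line. *)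
Lemma fracB_I01 (R : realType) (t : R) (f : R -> R) :
  lebesgue_measure.-integrable (@I01 R) (EFin \o f) ->
  lebesgue_measure.-integrable (@I01 R) (EFin \o (fun u => f (Defs.frac (t - u)))) /\
  \int[lebesgue_measure]_(u in @I01 R) f (Defs.frac (t - u)) =
  \int[lebesgue_measure]_(u in @I01 R) f u.
Proof.
have [s [s01 [h1 h2]]] := I01_fracB t; rewrite (I01_split s01) => fi.
have mA : measurable (`[0, s]%classic : set (measurableTypeR R)) by exact: measurable_itv.
have mB : measurable (`]s, 1[%classic : set (measurableTypeR R)) by exact: measurable_itv.
have dAB : [disjoint `[0, s]%classic & `]s, 1[%classic].
  apply/disj_setPS => x [] /=; rewrite !in_itv /= => /andP[_ ?] /andP[? _]; lra.
have mU := measurableU _ _ mA mB.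
have fA := integrableS mU mA (@subsetUl _ _ _) fi.
have fB := integrableS mU mB (@subsetUr _ _ _) fi.
have gA : lebesgue_measure.-integrable `[0, s] (EFin \o (fun u => f (Defs.frac (t - u)))).
  apply: eq_integrable (integrable_reflection mA (@reflection_cc _ s) fA) => //.
  by move=> u /set_mem us /=; rewrite h1.
have gB : lebesgue_measure.-integrable `]s, 1[ (EFin \o (fun u => f (Defs.frac (t - u)))).
  apply: eq_integrable (integrable_reflection mB (@reflection_oo _ s) fB) => //.
  by move=> u /set_mem us /=; rewrite h2.
have gU := integrable_setU mA mB dAB gA gB; split => //.
rewrite !Rintegral_setU //; congr (_ + _).
- rewrite -[RHS](Rintegral_reflection mA (@reflection_cc _ s) fA).
  by apply: eq_Rintegral => u /set_mem us; rewrite h1.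
- rewrite -[RHS](Rintegral_reflection mB (@reflection_oo _ s) fB).
  by apply: eq_Rintegral => u /set_mem us; rewrite h2.
Qed.

(** * Trigonometric polynomials and their convolution *)

Lemma cos_sin_2piz (R : realType) (z : int) :
  cos (2 * pi * z%:~R) = 1 :> R /\ sin (2 * pi * z%:~R) = 0 :> R.
Proof.
have c n : cos (2 * pi * n%:R) = 1 :> R by rewrite mulrC cos_eq1_cosMn // cos_2pi.
have s n := cos_eq1_sin (c n).
case: z => n; first by rewrite -pmulrn.
by rewrite NegzE rmorphN /= -pmulrn mulrN cosN sinN c s oppr0.
Qed.

Lemma cos_sin_frac (R : realType) (n : nat) (x : R) :
  cos (n%:R * (2 * pi * Defs.frac x)) = cos (n%:R * (2 * pi * x)) /\
  sin (n%:R * (2 * pi * Defs.frac x)) = sin (n%:R * (2 * pi * x)).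
Proof.
have -> : n%:R * (2 * pi * Defs.frac x) =
  n%:R * (2 * pi * x) - 2 * pi * (n%:Z * Num.floor x)%:~R.
  by rewrite /Defs.frac intrM -pmulrn; ring.
have [c s] := @cos_sin_2piz R (n%:Z * Num.floor x).
by rewrite cosB sinB c s; split; ring.
Qed.

(** The sum of the characters of T in the orbit of n under inversion; [wt] is the size of that
    orbit. *)
Definition chi (R : realType) (n : nat) (t : R) : R := wt R n * cos (n%:R * (2 * pi * t)).

Definition trigpoly (R : realType) (c : nat -> R) (K : nat) (t : R) : R :=
  \sum_(n < K) c n * chi n t.

Lemma chi_frac (R : realType) n (x : R) : chi n (Defs.frac x) = chi n x.
Proof. by rewrite /chi (cos_sin_frac n x).1. Qed.

Lemma trigpoly_frac (R : realType) (c : nat -> R) K (x : R) :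
  trigpoly c K (Defs.frac x) = trigpoly c K x.
Proof. by apply: eq_bigr => i _; rewrite chi_frac. Qed.

Lemma chiN (R : realType) n (x : R) : chi n (- x) = chi n x.
Proof. by rewrite /chi !mulrN cosN. Qed.

Lemma trigpolyN (R : realType) (c : nat -> R) K (x : R) :
  trigpoly c K (- x) = trigpoly c K x.
Proof. by apply: eq_bigr => i _; rewrite chiN. Qed.

(** The substitution u -> t - u is an involution modulo 1; this serves the commutativity of
    convolution. *)
Lemma trigpoly_reflect (R : realType) (c : nat -> R) (K : nat) (t u : R) :
  trigpoly c K (t - Defs.frac (t - u)) = trigpoly c K u.
Proof.
have -> : t - Defs.frac (t - u) = u + (Num.floor (t - u))%:~R by rewrite /Defs.frac; ring.
by rewrite -trigpoly_frac fracDz trigpoly_frac.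
Qed.

Lemma trigpoly_monomial (R : realType) (c : R) (n : nat) :
  (fun t => c * chi n t) = trigpoly (fun k => c * (k == n)%:R) n.+1.
Proof.
apply/funext => t; rewrite /trigpoly big_ord_recr /= eqxx mulr1 big1 ?add0r // => i _.
by rewrite ltn_eqF // mulr0 mul0r.
Qed.

Lemma continuous_2piM (R : realType) (a : R) : continuous (fun t : R => a * (2 * pi * t)).
Proof.
move=> x; apply: (@continuousM _ _ (fun=> a) (fun t => 2 * pi * t)); first exact: cvg_cst.
by apply: (@continuousM _ _ (fun=> 2 * pi) id); [exact: cvg_cst|exact: cvg_id].
Qed.

Lemma continuous_cosM (R : realType) (a : R) : continuous (fun t : R => cos (a * (2 * pi * t))).
Proof.
move=> x; apply: (@continuous_comp _ _ _ (fun t : R => a * (2 * pi * t)) cos).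
  exact: continuous_2piM.
exact: continuous_cos.
Qed.

Lemma continuous_sinM (R : realType) (a : R) : continuous (fun t : R => sin (a * (2 * pi * t))).
Proof.
move=> x; apply: (@continuous_comp _ _ _ (fun t : R => a * (2 * pi * t)) sin).
  exact: continuous_2piM.
exact: continuous_sin.
Qed.

Lemma continuous_chi (R : realType) n : continuous (@chi R n).
Proof.
move=> x; apply: (@continuousM _ _ (fun=> wt R n) (fun t => cos (n%:R * (2 * pi * t)))); first exact: cvg_cst.
exact: continuous_cosM.
Qed.

Lemma continuous_sum_ord (R : realType) (K : nat) (g : nat -> R -> R) :
  (forall n, continuous (g n)) -> continuous (fun t => \sum_(n < K) g n t).
Proof.
move=> cg; elim: K => [|K IH].
  have -> : (fun t => \sum_(n < 0) g n t) = cst 0 by apply/funext => t; rewrite big_ord0.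
  exact: cst_continuous.
have -> : (fun t => \sum_(n < K.+1) g n t) = (fun t => \sum_(n < K) g n t + g K t).
  by apply/funext => t; rewrite big_ord_recr.
by move=> x; apply: continuousD; [exact: IH|exact: cg].
Qed.

Lemma continuous_trigpoly (R : realType) (c : nat -> R) K : continuous (trigpoly c K).
Proof.
apply: (@continuous_sum_ord _ K (fun n t => c n * chi n t)) => n x.
apply: (@continuousM _ _ (fun=> c n) (@chi R n)); first exact: cvg_cst.
exact: continuous_chi.
Qed.

Lemma continuous_subl (R : realType) (g : R -> R) (t : R) : continuous g ->
  continuous (fun u => g (t - u)).
Proof.
move=> cg x; apply: (@continuous_comp _ _ _ (fun u => t - u) g); last exact: cg.
by apply: (@continuousB _ _ _ (fun=> t) id); [exact: cvg_cst|exact: cvg_id].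
Qed.

Lemma Rintegral_sum_ord (R : realType) (K : nat) (g : nat -> R -> R) :
  (forall n, lebesgue_measure.-integrable (@I01 R) (EFin \o g n)) ->
  lebesgue_measure.-integrable (@I01 R) (EFin \o (fun u => \sum_(n < K) g n u)) /\
  \int[lebesgue_measure]_(u in @I01 R) \sum_(n < K) g n u =
  \sum_(n < K) \int[lebesgue_measure]_(u in @I01 R) g n u.
Proof.
have mI := @measurable_I01 R.
move=> ig; elim: K => [|K [IH1 IH2]].
  have -> : (fun u => \sum_(n < 0) g n u) = cst 0 by apply/funext => t; rewrite big_ord0.
  split; first exact: integrable0.
  by rewrite big_ord0 Rintegral_cst // mul0r.
have -> : (fun u => \sum_(n < K.+1) g n u) = (fun u => \sum_(n < K) g n u + g K u).
  by apply/funext => t; rewrite big_ord_recr.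
split; last by rewrite RintegralD // IH2 big_ord_recr.
exact: (integrableD mI IH1 (ig K)).
Qed.

(* Translating by half a period changes the sign of the cosine. *)
Lemma Rintegral_cosn (R : realType) (n : nat) :
  \int[lebesgue_measure]_(u in @I01 R) cos (n%:R * (2 * pi * u)) = (n == 0)%:R.
Proof.
have mI := @measurable_I01 R.
case: n => [|n].
  under eq_Rintegral do rewrite mul0r cos0.
  exact: Rintegral_cst01.
set I := \int[_]_(_ in _) _.
have ic := continuous_integrable01 (@continuous_cosM R n.+1%:R).
have [_ h] := fracB_I01 (2 * n.+1%:R)^-1 ic.
have : - I = I.
  rewrite {2}/I -h -mulN1r -RintegralZl //; apply: eq_Rintegral => u _.
  rewrite (cos_sin_frac _ _).1 mulN1r.
  have -> : n.+1%:R * (2 * pi * ((2 * n.+1%:R)^-1 - u)) = pi - n.+1%:R * (2 * pi * u).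
    by field; rewrite addrC natr1 pnatr_eq0.
  by rewrite cosB cospi sinpi mul0r addr0 mulN1r.
by rewrite eqn0Ngt mulr0n => ?; lra.
Qed.

(** Pairing the plain cosine with the weighted one gives 1 for n = m = 0 as well as for n = m > 0,
    so integration against cos_n reads off the coefficients of a [trigpoly]. *)
Lemma Rintegral_chi (R : realType) (n m : nat) :
  \int[lebesgue_measure]_(u in @I01 R) (cos (n%:R * (2 * pi * u)) * chi m u) = (n == m)%:R.
Proof.
have mI := @measurable_I01 R.
have ic k := continuous_integrable01 (@continuous_cosM R k%:R).
transitivity (\int[lebesgue_measure]_(u in @I01 R)
   (wt R m / 2 * (cos ((n + m)%:R * (2 * pi * u)) + cos (((n - m) + (m - n))%:R * (2 * pi * u))))).
  by apply: eq_Rintegral => u _; rewrite /chi mulrCA cosMcos; field.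
rewrite RintegralZl //; last exact: (integrableD mI (ic _) (ic _)).
rewrite RintegralD // !Rintegral_cosn !addn_eq0 !subn_eq0 -eqn_leq.
have [->|nm] := eqVneq n m; first by case: m => [|m] /=; field.
suff -> : (n == 0) && (m == 0) = false by rewrite /= addr0 mulr0.
by apply: contra_neqF nm => /andP[/eqP -> /eqP ->].
Qed.

Lemma Rintegral_trigpoly (R : realType) (c : nat -> R) (K n : nat) : (n < K)%N ->
  \int[lebesgue_measure]_(u in @I01 R) (cos (n%:R * (2 * pi * u)) * trigpoly c K u) = c n.
Proof.
move=> nK; have mI := @measurable_I01 R.
have i m : lebesgue_measure.-integrable (@I01 R) (EFin \o (fun u => cos (n%:R * (2 * pi * u)) * chi m u)).
  by apply: integrable01_mull; [exact: continuous_cosM|apply: continuous_integrable01; exact: continuous_chi].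
have ci m : lebesgue_measure.-integrable (@I01 R) (EFin \o (fun u => c m * (cos (n%:R * (2 * pi * u)) * chi m u))).
  exact: integrable01_Zl.
transitivity (\int[lebesgue_measure]_(u in @I01 R)
   \sum_(m < K) c m * (cos (n%:R * (2 * pi * u)) * chi m u)).
  by apply: eq_Rintegral => u _; rewrite mulr_sumr; apply: eq_bigr => m _; rewrite mulrCA.
rewrite (@Rintegral_sum_ord _ K (fun m u => c m * (cos (n%:R * (2 * pi * u)) * chi m u)) ci).2.
rewrite (bigD1 (Ordinal nK)) //= RintegralZl // Rintegral_chi eqxx mulr1 big1 ?addr0 // => m mn.
rewrite RintegralZl // Rintegral_chi; suff -> : (n == m :> nat) = false by rewrite mulr0.
by apply: contra_neqF mn => /eqP nm; exact/val_inj.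
Qed.

(** * Cosine and sine coefficients, and convolution as a multiplier *)

Definition coscoef (R : realType) (h : R -> R) (n : nat) : R :=
  \int[lebesgue_measure]_(u in @I01 R) (cos (n%:R * (2 * pi * u)) * h u).

Definition sincoef (R : realType) (h : R -> R) (n : nat) : R :=
  \int[lebesgue_measure]_(u in @I01 R) (sin (n%:R * (2 * pi * u)) * h u).

(** Convolution on the circle without [frac], since the kernel has period 1. *)
Definition trigconv (R : realType) (c : nat -> R) (K : nat) (h : R -> R) (t : R) : R :=
  \int[lebesgue_measure]_(u in @I01 R) (trigpoly c K (t - u) * h u).

(** The addition formula for the cosine separates t from u: the operator has finite rank. *)
Lemma trigconvE (R : realType) (c : nat -> R) (K : nat) (h : R -> R) (t : R) :
  lebesgue_measure.-integrable (@I01 R) (EFin \o h) ->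
  trigconv c K h t = \sum_(n < K) c n * wt R n *
    (cos (n%:R * (2 * pi * t)) * coscoef h n + sin (n%:R * (2 * pi * t)) * sincoef h n).
Proof.
move=> ih; have mI := @measurable_I01 R.
pose f n u := c n * wt R n * cos (n%:R * (2 * pi * t)) * (cos (n%:R * (2 * pi * u)) * h u).
pose g n u := c n * wt R n * sin (n%:R * (2 * pi * t)) * (sin (n%:R * (2 * pi * u)) * h u).
have fi n : lebesgue_measure.-integrable (@I01 R) (EFin \o (fun u => (cos (n%:R * (2 * pi * u)) * h u))).
  by apply: integrable01_mull => //; exact: continuous_cosM.
have gi n : lebesgue_measure.-integrable (@I01 R) (EFin \o (fun u => (sin (n%:R * (2 * pi * u)) * h u))).
  by apply: integrable01_mull => //; exact: continuous_sinM.
have fi' n : lebesgue_measure.-integrable (@I01 R) (EFin \o f n).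
  exact: integrable01_Zl.
have gi' n : lebesgue_measure.-integrable (@I01 R) (EFin \o g n).
  exact: integrable01_Zl.
transitivity (\int[lebesgue_measure]_(u in @I01 R) \sum_(n < K) (f n u + g n u)).
  apply: eq_Rintegral => u _; rewrite mulr_suml; apply: eq_bigr => n _.
  by rewrite /chi /f /g !mulrBr cosB; ring.
rewrite (@Rintegral_sum_ord _ K (fun n u => f n u + g n u) _).2; last first.
  by move=> n; exact: (integrableD mI (fi' n) (gi' n)).
apply: eq_bigr => n _; rewrite (RintegralD mI (fi' n) (gi' n)).
by rewrite RintegralZl // RintegralZl // /coscoef /sincoef; ring.
Qed.

Lemma continuous_trigconv (R : realType) (c : nat -> R) (K : nat) (h : R -> R) :
  lebesgue_measure.-integrable (@I01 R) (EFin \o h) -> continuous (trigconv c K h).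
Proof.
move=> ih.
pose a n t := cos (n%:R * (2 * pi * t)) * coscoef h n.
pose b n t := sin (n%:R * (2 * pi * t)) * sincoef h n.
have -> : trigconv c K h = (fun t => \sum_(n < K) c n * wt R n * (a n t + b n t)).
  by apply/funext => t; exact: trigconvE.
apply: (@continuous_sum_ord _ K (fun n t => c n * wt R n * (a n t + b n t))) => n x.
apply: (@continuousM _ _ (fun=> c n * wt R n) (fun t => a n t + b n t)); first exact: cvg_cst.
apply: (@continuousD _ _ _ (a n) (b n)).
  by apply: (@continuousM _ _ (fun t => cos (n%:R * (2 * pi * t))) (fun=> coscoef h n)); [exact: continuous_cosM|exact: cvg_cst].
by apply: (@continuousM _ _ (fun t => sin (n%:R * (2 * pi * t))) (fun=> sincoef h n)); [exact: continuous_sinM|exact: cvg_cst].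
Qed.

Lemma trigconvB (R : realType) (c : nat -> R) (K : nat) (f g : R -> R) (t : R) :
  lebesgue_measure.-integrable (@I01 R) (EFin \o f) ->
  lebesgue_measure.-integrable (@I01 R) (EFin \o g) ->
  trigconv c K (fun u => f u - g u) t = trigconv c K f t - trigconv c K g t.
Proof.
move=> fi gi; have mI := @measurable_I01 R.
have cc : continuous (fun u => trigpoly c K (t - u)).
  by apply: continuous_subl; exact: continuous_trigpoly.
rewrite /trigconv -(RintegralB mI (integrable01_mull cc fi) (integrable01_mull cc gi)).
by apply: eq_Rintegral => u _; rewrite mulrBr.
Qed.

Definition even01 (R : realType) (h : R -> R) : Prop :=
  {ae lebesgue_measure, forall x, @I01 R x -> h (Defs.frac (- x)) = h x}.

Lemma sincoef_even (R : realType) (h : R -> R) (n : nat) :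
  lebesgue_measure.-integrable (@I01 R) (EFin \o h) -> even01 h -> sincoef h n = 0.
Proof.
move=> ih eh; have mI := @measurable_I01 R.
have i : lebesgue_measure.-integrable (@I01 R) (EFin \o (fun u => (sin (n%:R * (2 * pi * u)) * h u))).
  by apply: integrable01_mull => //; exact: continuous_sinM.
(* At t = 0 the invariance is u -> -u. The integrand is odd almost everywhere, so its integral
   equals its own negative. *)
have [i0 e0] := fracB_I01 0 i.
suff : - sincoef h n = sincoef h n by move=> ?; lra.
rewrite {2}/sincoef -e0 -mulN1r -RintegralZl //; congr fine; apply: ae_eq_integral => //.
- by case/integrableP : (integrable01_Zl (-1) i).
- by case/integrableP : i0.
case: eh => N [mN N0 subN]; exists N; split => //.
apply: subset_trans subN => u /= /[swap] hu; apply => Iu; have {}hu := hu Iu.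
by rewrite /= sub0r hu (cos_sin_frac _ _).2 !mulrN sinN mulN1r mulNr.
Qed.

Lemma trigconv_even (R : realType) (c : nat -> R) (K : nat) (h : R -> R) (t : R) :
  lebesgue_measure.-integrable (@I01 R) (EFin \o h) -> even01 h ->
  trigconv c K h t = trigpoly (fun n => c n * coscoef h n) K t.
Proof.
move=> ih eh; rewrite trigconvE //; apply: eq_bigr => n _.
by rewrite sincoef_even // /chi; ring.
Qed.

Lemma even01_trigpoly (R : realType) (c : nat -> R) (K : nat) : even01 (trigpoly c K).
Proof. by apply: aeW => x _; rewrite trigpoly_frac trigpolyN. Qed.

Lemma integrable_trigpoly (R : realType) (c : nat -> R) (K : nat) :
  lebesgue_measure.-integrable (@I01 R) (EFin \o trigpoly c K).
Proof. by apply: continuous_integrable01; exact: continuous_trigpoly. Qed.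

Lemma trigconv_trigpoly (R : realType) (c d : nat -> R) (K : nat) (t : R) :
  trigconv c K (trigpoly d K) t = trigpoly (fun n => c n * d n) K t.
Proof.
rewrite trigconv_even; [|exact: integrable_trigpoly|exact: even01_trigpoly].
by apply: eq_bigr => n _; rewrite /coscoef Rintegral_trigpoly.
Qed.

(** * Fejer's theorem in L^1 *)

(* Truncated subtraction makes the coefficient vanish for n > N. *)
Definition fcoef (R : realType) (N n : nat) : R := (N.+1 - n)%:R / N.+1%:R.

Lemma fcoef0 (R : realType) (N : nat) : fcoef R N 0 = 1.
Proof. by rewrite /fcoef subn0 divff // pnatr_eq0. Qed.

Lemma fcoef_ge (R : realType) (N n : nat) : (N < n)%N -> fcoef R N n = 0.
Proof. by move=> Nn; rewrite /fcoef (eqP Nn) mul0r. Qed.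

Definition fejer (R : realType) (N : nat) : R -> R := trigpoly (@fcoef R N) N.+1.

Lemma fejerE (R : realType) (N : nat) (x : R) :
  fejer N x = N.+1%:R^-1 *
    \sum_(n < N.+1) (N.+1 - n)%:R * (wt R n * cos (n%:R * (2 * pi * x))).
Proof.
rewrite /fejer /trigpoly mulr_sumr; apply: eq_bigr => n _.
by rewrite /fcoef /chi [_ / _]mulrC -!mulrA.
Qed.

Lemma fejer_ge0 (R : realType) (N : nat) (x : R) : 0 <= fejer N x.
Proof. by rewrite fejerE mulr_ge0 // fejer_kernel_ge0. Qed.

(** The closed form makes the left side (1 - cos ((N + 1) y)) / (N + 1) with y = 2 pi x. This is the
    decay that Korovkin's test function needs. *)
Lemma fejer_concentration (R : realType) (N : nat) (x : R) :
  fejer N x * (1 - cos (2 * pi * x)) <= 2 / N.+1%:R.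
Proof.
have e := fejer_kernelE N.+1 (2 * pi * x).
rewrite fejerE mulrAC -mulrA [(1 - _) * _]e mulrC ler_pM2r ?invr_gt0 ?ltr0n //.
by have := cos_geN1 (N.+1%:R * (2 * pi * x)); lra.
Qed.

Lemma continuous_fejer (R : realType) (N : nat) : continuous (@fejer R N).
Proof. exact: continuous_trigpoly. Qed.

Lemma Rintegral_trigpoly_subl (R : realType) (c : nat -> R) (K : nat) (t : R) :
  \int[lebesgue_measure]_(u in @I01 R) trigpoly c K.+1 (t - u) = c 0.
Proof.
under eq_Rintegral do rewrite -trigpoly_frac.
rewrite (fracB_I01 t (integrable_trigpoly c K.+1)).2 -(@Rintegral_trigpoly _ c K.+1 0) //.
by apply: eq_Rintegral => u _; rewrite mul0r cos0 mul1r.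
Qed.

Lemma Rintegral_fejer_subl (R : realType) (N : nat) (t : R) :
  \int[lebesgue_measure]_(u in @I01 R) fejer N (t - u) = 1.
Proof. exact: etrans (Rintegral_trigpoly_subl _ _ _) (fcoef0 _ _). Qed.

Lemma integral_fejer_subr (R : realType) (N : nat) (u : R) :
  (\int[lebesgue_measure]_(t in @I01 R) (fejer N (t - u))%:E = 1)%E.
Proof.
have i : lebesgue_measure.-integrable (@I01 R) (EFin \o (fun t => fejer N (u - t))).
  by apply: continuous_integrable01; apply: continuous_subl; exact: continuous_fejer.
transitivity (\int[lebesgue_measure]_(t in @I01 R) (EFin \o (fun t => fejer N (u - t))) t)%E.
  by apply: eq_integral => t _; rewrite /= /fejer -trigpolyN opprB.
rewrite -[LHS]fineK; last by apply: integrable_fin_num => //; exact: measurable_I01.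
by congr EFin; exact: Rintegral_fejer_subl.
Qed.

(** Young's inequality for a kernel that is nonnegative and of mass 1, by Tonelli. *)
Lemma fejer_contraction (R : realType) (N : nat) (h : R -> R) :
  lebesgue_measure.-integrable (@I01 R) (EFin \o h) ->
  (\int[lebesgue_measure]_(t in @I01 R) (`|trigconv (fcoef R N) N.+1 h t|)%:E <=
   \int[lebesgue_measure]_(t in @I01 R) (`|h t|)%:E)%E.
Proof.
move=> ih; have mI := @measurable_I01 R.
have mh : measurable_fun (@I01 R) h by case/integrableP: ih => /measurable_EFinP.
(* Both variables are extended to the line, u by a zero extension and t through an indicator, so
   that Tonelli applies to a nonnegative function on the whole plane. *)
pose H := (fun u => `|h u|) \_ (@I01 R).
have mH : measurable_fun setT H.
  by rewrite /H; apply/(measurable_restrictT _ mI); exact: measurableT_comp mh.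
have H0 u : 0 <= H u by rewrite /H patchE; case: ifP.
pose Phi (z : measurableTypeR R * measurableTypeR R) : \bar R :=
  (\1_(@I01 R) z.1 * (fejer N (z.1 - z.2) * H z.2))%:E.
have m1 : measurable_fun setT (\1_(@I01 R) : measurableTypeR R -> R).
  apply: measurable_indic; exact: mI.
have mF := continuous_measurable_fun (@continuous_fejer R N).
have mPhi : measurable_fun setT Phi.
  apply/measurable_EFinP; apply: measurable_funM.
    exact: (measurableT_comp m1 measurable_fst).
  apply: measurable_funM; last exact: (measurableT_comp mH measurable_snd).
  apply: (measurableT_comp mF).
  by apply: measurable_funB.
have Phi0 z : (0 <= Phi z)%E.
  by rewrite lee_fin; do 2?apply: mulr_ge0 => //; exact: fejer_ge0.
have mT : measurable_fun (@I01 R) (fun t => (`|trigconv (fcoef R N) N.+1 h t|)%:E).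
  apply/measurable_EFinP; apply: measurableT_comp => //; apply: measurable_funTS.
  exact: (continuous_measurable_fun (continuous_trigconv ih)).
apply: (@le_trans _ _ (\int[lebesgue_measure]_t \int[lebesgue_measure]_u Phi (t, u))%E).
  rewrite integral_mkcond; apply: ge0_le_integral => //.
  - by move=> t _; rewrite patchE; case: ifP.
  - by apply/(measurable_restrictT _ mI).
  - exact: measurable_fun_fubini_tonelli_F.
  - move=> t _; rewrite patchE; case: ifPn => tI; last exact: integral_ge0.
    have i : lebesgue_measure.-integrable (@I01 R) (EFin \o (fun u => fejer N (t - u) * h u)).
      by apply: integrable01_mull => //; apply: continuous_subl; exact: continuous_fejer.
    rewrite EFin_normr_Rintegral //.
    apply: (le_trans (le_abse_integral _ mI _)); first by case/integrableP: i.
    rewrite integral_mkcond le_eqVlt; apply/orP; left; apply/eqP; apply: eq_integral => u _.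
    rewrite /Phi /= /H !patchE indicE tI mul1r; case: ifP => _; last by rewrite mulr0.
    by rewrite normrM ger0_norm // fejer_ge0.
rewrite (fubini_tonelli _ mPhi Phi0) [leRHS]integral_mkcond le_eqVlt; apply/orP; left; apply/eqP.
apply: eq_integral => u _.
transitivity (\int[lebesgue_measure]_(t in @I01 R) ((H u)%:E * (fejer N (t - u))%:E))%E.
  rewrite [RHS]integral_mkcond; apply: eq_integral => t _.
  rewrite /Phi /= patchE indicE; case: ifP => _; last by rewrite mul0r.
  by rewrite mul1r mulrC.
rewrite ge0_integralZl_EFin //.
- by rewrite integral_fejer_subr mule1 /H !patchE; case: ifP.
- by move=> t _; rewrite lee_fin fejer_ge0.
- apply/measurable_EFinP; apply: measurable_funTS; apply: (measurableT_comp mF).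
  by apply: measurable_funB.
Qed.

(** * Korovkin's argument and convergence of the Fejer means *)

Lemma cos_le_far (R : realType) (d x : R) : 0 < d -> d <= x <= 1 - d ->
  cos (2 * pi * x) <= cos (2 * pi * d).
Proof.
move=> d0 /andP[dx xd]; have p0 := @pi_gt0 R.
(* On the first half period the cosine decreases; the second half reduces to it by x -> 1 - x. *)
have key y : d <= y <= 2^-1 -> cos (2 * pi * y) <= cos (2 * pi * d).
  move=> /andP[dy y2]; rewrite leNgt; apply/negP => h.
  have : (2 * pi * y < 2 * pi * d).
    by rewrite -ltr_cos // in_itv /=; apply/andP; split; nra.
  by nra.
have [x2|x2] := leP x 2^-1; first by apply: key; rewrite dx.
have -> : cos (2 * pi * x) = cos (2 * pi * (1 - x)).
  have [c s] := @cos_sin_2piz R 1.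
  by rewrite mulrBr cosB -[1]/(1%:~R) c s mul1r mul0r addr0.
by apply: key; apply/andP; split; lra.
Qed.

(* Korovkin's device: off the point t the modulus of continuity is absorbed by
   the test function 1 - cos (2 pi (t - u)). *)
Lemma korovkin_bound (R : realType) (g : R -> R) (t e : R) : continuous g ->
  0 < t < 1 -> 0 < e -> exists2 C : R, 0 <= C &
    forall u, @I01 R u -> `|g u - g t| <= e + C * (1 - cos (2 * pi * (t - u))).
Proof.
move=> cg /andP[t0 t1] e0.
have [M M0 hM] := continuous_bounded01 cg.
have /cvgrPdist_le/(_ _ e0) := cg t.
rewrite near_nbhs => /nbhs_ballP[d /= d0 hd].
(* The bounds by t and 1 - t keep [|t - u|] at most 1 - d' for u in [0, 1), away from 1, where the
   cosine returns to 1 although u is far from t on the line. *)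
pose d' := Num.min (Num.min d t) (1 - t).
have d'0 : 0 < d' by rewrite !lt_min d0 t0 subr_gt0.
have d'd : d' <= d by rewrite !ge_min lexx.
have d't : d' <= t by rewrite !ge_min lexx orbT.
have d't1 : d' <= 1 - t by rewrite !ge_min lexx orbT.
have k0 : 0 < 1 - cos (2 * pi * d').
  by rewrite subr_gt0; have p0 := @pi_gt0 R; apply: cos_lt1; apply/andP; split; nra.
(* Away from t the difference is at most 2 M, while the test function is at least 1 - cos (2 pi
   d'). *)
exists (2 * M / (1 - cos (2 * pi * d'))).
  by rewrite divr_ge0 ?mulr_ge0 // ltW.
move=> u Iu; have [c0 c1] : 0 <= 1 - cos (2 * pi * (t - u)) /\ 0 <= 2 * M / (1 - cos (2 * pi * d')).
  by split; [rewrite subr_ge0 cos_le1|rewrite divr_ge0 ?mulr_ge0 // ltW].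
have [ud|ud] := ltP `|t - u| d'.
  apply: (@le_trans _ _ e); last by rewrite lerDl mulr_ge0.
  by rewrite distrC; apply: hd; rewrite /ball /=; exact: lt_le_trans d'd.
have cc : cos (2 * pi * (t - u)) <= cos (2 * pi * d').
  have -> : cos (2 * pi * (t - u)) = cos (2 * pi * `|t - u|).
    by case: (ltrP 0 (t - u)) => h; [rewrite gtr0_norm|rewrite ler0_norm // mulrN cosN].
  apply: cos_le_far => //; rewrite ud /=.
  move: Iu; rewrite /I01 /= in_itv /= => /andP[u0 u1].
  by rewrite ler_norml; apply/andP; split; lra.
apply: (@le_trans _ _ (2 * M)).
  apply: (le_trans (ler_normB _ _)).
  have It : @I01 R t by rewrite /I01 /= in_itv /= ltW.
  by have := hM _ Iu; have := hM _ It; lra.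
rewrite -[leLHS]add0r lerD ?(ltW e0) // mulrAC ler_pdivlMr //.
by rewrite ler_wpM2l ?mulr_ge0 // lerD2l lerN2.
Qed.

(** Unit mass moves the constant [g t] under the integral, and positivity removes the absolute value
    of the kernel. *)
Lemma trigconv_fejer_diff (R : realType) (N : nat) (g : R -> R) (t : R) : continuous g ->
  `|trigconv (fcoef R N) N.+1 g t - g t| <=
  \int[lebesgue_measure]_(u in @I01 R) (fejer N (t - u) * `|g u - g t|).
Proof.
move=> cg; have mI := @measurable_I01 R.
have cF : continuous (fun u => fejer N (t - u)) by apply: continuous_subl; exact: continuous_fejer.
have ig := continuous_integrable01 cg.
have i1 := integrable01_mull cF ig.
have iF := continuous_integrable01 cF.
have -> : trigconv (fcoef R N) N.+1 g t - g t =
  \int[lebesgue_measure]_(u in @I01 R) (fejer N (t - u) * g u - g t * fejer N (t - u)).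
  rewrite RintegralB //; last exact: integrable01_Zl.
  by rewrite RintegralZl // Rintegral_fejer_subl mulr1.
apply: (le_trans (le_normr_Rintegral mI _)).
  by have := integrableB mI i1 (integrable01_Zl (g t) iF).
rewrite le_eqVlt; apply/orP; left; apply/eqP; apply: eq_Rintegral => u _.
by rewrite [g t * _]mulrC -mulrBr normrM ger0_norm // fejer_ge0.
Qed.

Lemma integrable_fejer_dist (R : realType) (N : nat) (g : R -> R) (t : R) : continuous g ->
  lebesgue_measure.-integrable (@I01 R) (EFin \o (fun u => fejer N (t - u) * `|g u - g t|)).
Proof.
move=> cg; apply: integrable01_mull; first by apply: continuous_subl; exact: continuous_fejer.
apply: continuous_integrable01 => x.
apply: (@continuous_comp _ _ _ (fun u => g u - g t) Num.norm); last exact: norm_continuous.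
by apply: (@continuousB _ _ _ g (fun=> g t)); [exact: cg|exact: cvg_cst].
Qed.

(** As g is continuous on the line but may differ at 0 and 1, it can jump at the base point of the
    circle; hence only interior t. *)
Lemma trigconv_fejer_cvg (R : realType) (g : R -> R) (t : R) : continuous g -> 0 < t < 1 ->
  trigconv (fcoef R N) N.+1 g t @[N --> \oo] --> g t.
Proof.
move=> cg t01; have mI := @measurable_I01 R; apply/cvgrPdist_le => e e0.
have e20 : 0 < e / 2 by rewrite divr_gt0.
have [C C0 hC] := korovkin_bound cg t01 e20.
have cF N : continuous (fun u => fejer N (t - u)) by apply: continuous_subl; exact: continuous_fejer.
have bound N : `|g t - trigconv (fcoef R N) N.+1 g t| <= e / 2 + C * (2 / N.+1%:R).
  rewrite distrC; apply: (le_trans (trigconv_fejer_diff _ _ cg)).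
  have -> : e / 2 + C * (2 / N.+1%:R) = \int[lebesgue_measure]_(u in @I01 R)
     (e / 2 * fejer N (t - u) + C * (2 / N.+1%:R)).
    have i1 := integrable01_Zl (e / 2) (continuous_integrable01 (cF N)).
    have i2 : lebesgue_measure.-integrable (@I01 R) (EFin \o (fun=> C * (2 / N.+1%:R))).
      by apply: continuous_integrable01 => x; exact: cvg_cst.
    rewrite (RintegralD mI i1 i2) (RintegralZl _ mI (continuous_integrable01 (cF N))).
    by rewrite Rintegral_fejer_subl mulr1 Rintegral_cst01.
  apply: le_Rintegral => //; first exact: integrable_fejer_dist.
  - apply: continuous_integrable01 => x.
    apply: (@continuousD _ _ _ (fun u => e / 2 * fejer N (t - u)) (fun=> C * (2 / N.+1%:R))); last exact: cvg_cst.
    by apply: (@continuousM _ _ (fun=> e / 2) (fun u => fejer N (t - u))); [exact: cvg_cst|exact: cF].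
  - move=> u Iu; apply: (le_trans (ler_wpM2l (fejer_ge0 _ _) (hC u Iu))).
    rewrite mulrDr [fejer _ _ * (e / 2)]mulrC lerD2l mulrCA ler_wpM2l //.
    exact: fejer_concentration.
(* Chosen so that 2 C / (N + 1) is at most e / 2. *)
exists (Num.truncn (4 * C / e)).+1 => // N /= hN.
apply: (le_trans (bound N)).
have N0 : 0 < N.+1%:R :> R by rewrite ltr0n.
have ee : e = e / 2 + e / 2 by lra.
rewrite [leRHS]ee lerD2l mulrA ler_pdivrMr //.
have h1 : 4 * C / e < N.+1%:R.
  apply: (lt_le_trans (truncnS_gt _)); rewrite ler_nat; exact: ltnW.
by move: h1; rewrite ltr_pdivrMr // => h1; nra.
Qed.

Lemma trigconv_fejer_le (R : realType) (N : nat) (g : R -> R) (M t : R) :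
  continuous g -> (forall u, @I01 R u -> `|g u| <= M) -> @I01 R t ->
  `|trigconv (fcoef R N) N.+1 g t - g t| <= 2 * M.
Proof.
move=> cg hM It; have mI := @measurable_I01 R.
have cF : continuous (fun u => fejer N (t - u)) by apply: continuous_subl; exact: continuous_fejer.
apply: (le_trans (trigconv_fejer_diff _ _ cg)).
have -> : 2 * M = \int[lebesgue_measure]_(u in @I01 R) (2 * M * fejer N (t - u)).
  rewrite RintegralZl //; last exact: (continuous_integrable01 cF).
  by rewrite Rintegral_fejer_subl mulr1.
apply: le_Rintegral => //; first exact: integrable_fejer_dist.
- by apply: integrable01_Zl; exact: (continuous_integrable01 cF).
- move=> u Iu; rewrite [leRHS]mulrC ler_wpM2l ?fejer_ge0 //.
  apply: (le_trans (ler_normB _ _)).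
  by have := hM _ Iu; have := hM _ It; lra.
Qed.

Lemma fejer_L1_cvg_continuous (R : realType) (g : R -> R) : continuous g ->
  (\int[lebesgue_measure]_(t in @I01 R) (`|trigconv (fcoef R N) N.+1 g t - g t|)%:E)%E
    @[N --> \oo] --> 0%E.
Proof.
move=> cg.
have [M M0 hM] := continuous_bounded01 cg.
have ig := continuous_integrable01 cg.
have cD N : continuous (fun t => `|trigconv (fcoef R N) N.+1 g t - g t|).
  move=> x; apply: (@continuous_comp _ _ _ (fun t => trigconv (fcoef R N) N.+1 g t - g t) Num.norm); last exact: norm_continuous.
  by apply: (@continuousB _ _ _ _ g); [exact: continuous_trigconv|exact: cg].
have mJ : measurable (`]0, 1[%classic : set (measurableTypeR R)) by exact: measurable_itv.
have IJ : (`]0, 1[%classic : set R) `<=` @I01 R.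
  by move=> x; rewrite /I01 /= !in_itv /= => /andP[/ltW -> ->].
have mD N : measurable_fun (`]0%R, 1%R[%classic : set R) (fun t => (`|trigconv (fcoef R N) N.+1 g t - g t|)%:E).
  by apply/measurable_EFinP; apply: measurable_funTS; exact: continuous_measurable_fun.
(* Dropping the null endpoint 0 leaves the open interval, on which pointwise convergence is
   known. *)
have -> : (fun N => \int[lebesgue_measure]_(t in @I01 R) (`|trigconv (fcoef R N) N.+1 g t - g t|)%:E)%E =
  (fun N => \int[lebesgue_measure]_(t in `]0%R, 1%R[) (`|trigconv (fcoef R N) N.+1 g t - g t|)%:E)%E.
  by apply/funext => N; exact: integral_itv_bndoo.
have [] := @dominated_convergence _ _ R lebesgue_measure `]0%R, 1%R[%classic mJ
  (fun N t => (`|trigconv (fcoef R N) N.+1 g t - g t|)%:E) (fun=> 0%E) (fun=> (2 * M)%:E) mD.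
- exact: measurable_cst.
- apply: aeW => t; rewrite /= in_itv /= => t01.
  apply/fine_cvgP; split; first exact: nearW.
  by apply/norm_cvg0P/subr_cvg0; exact: trigconv_fejer_cvg.
- by apply: (integrableS (@measurable_I01 R) mJ IJ); apply: continuous_integrable01 => x; exact: cvg_cst.
- apply: aeW => t N /IJ It; rewrite abse_EFin normr_id lee_fin.
  exact: trigconv_fejer_le.
by move=> _ _; rewrite integral0.
Qed.

Lemma cvge0_lt (R : realType) (u : nat -> \bar R) (e : R) :
  u n @[n --> \oo] --> 0%E -> 0 < e ->
  exists N0 : nat, forall N, (N0 <= N)%N -> (u N < e%:E)%E.
Proof.
move=> /fine_cvgP[[N1 _ h1] h] e0.
have /cvgrPdist_lt/(_ _ e0)[N2 _ h2] := h.
exists (maxn N1 N2) => N; rewrite geq_max => /andP[N1N N2N].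
rewrite -(fineK (h1 N N1N)) lte_fin.
by have := h2 N N2N; rewrite /= sub0r normrN => /ltr_normlW.
Qed.

Lemma measurable_norm_EFin (R : realType) (f : R -> R) :
  lebesgue_measure.-integrable (@I01 R) (EFin \o f) ->
  measurable_fun (@I01 R) (fun t => (`|f t|)%:E).
Proof.
by case/integrableP => /measurable_EFinP mf _; apply/measurable_EFinP; exact: measurableT_comp.
Qed.

(** Continuous functions are dense in L^1, and the contraction property carries the approximation
    over to the means uniformly in N; each of the three errors is below e / 3. *)
Lemma fejer_L1_cvg (R : realType) (h : R -> R) (e : R) :
  lebesgue_measure.-integrable (@I01 R) (EFin \o h) -> 0 < e ->
  exists N0 : nat, forall N, (N0 <= N)%N ->
  (\int[lebesgue_measure]_(t in @I01 R) (`|trigconv (fcoef R N) N.+1 h t - h t|)%:E < e%:E)%E.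
Proof.
move=> ih e0; have mI := @measurable_I01 R.
have fI : (lebesgue_measure (@I01 R) < +oo)%E by rewrite lebesgue_I01 ltry.
have e3 : 0 < e / 3 by rewrite divr_gt0.
have [g_ [cg_ ig_ cvg_]] := approximation_continuous_integrable mI fI ih.
have [k /(_ k (leqnn _)) hg] := cvge0_lt cvg_ e3.
have cg := cg_ k; move: hg; set g := g_ k => hg.
have ig : lebesgue_measure.-integrable (@I01 R) (EFin \o g) := ig_ k.
have [N0 h0] := cvge0_lt (fejer_L1_cvg_continuous cg) e3.
exists N0 => N /h0 {}h0.
have ihg : lebesgue_measure.-integrable (@I01 R) (EFin \o (fun t => h t - g t)).
  by have := integrableB mI ih ig.
have iT f (i : lebesgue_measure.-integrable (@I01 R) (EFin \o f)) :=
  continuous_integrable01 (continuous_trigconv (c := fcoef R N) (K := N.+1) i).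
have hc := fejer_contraction N ihg.
have ma := measurable_norm_EFin (iT _ ihg).
have mb : measurable_fun (@I01 R) (fun t => (`|trigconv (fcoef R N) N.+1 g t - g t|)%:E).
  by apply: (@measurable_norm_EFin _ (fun t => trigconv (fcoef R N) N.+1 g t - g t)); have := integrableB mI (iT _ ig) ig.
have mc := measurable_norm_EFin ihg.
apply: (@le_lt_trans _ _ (\int[lebesgue_measure]_(t in @I01 R)
   ((`|trigconv (fcoef R N) N.+1 (fun t => h t - g t)%R t|)%:E +
     ((`|trigconv (fcoef R N) N.+1 g t - g t|)%:E + (`|h t - g t|)%:E)))%E).
  apply: ge0_le_integral => //.
  - by apply: (@measurable_norm_EFin _ (fun t => trigconv (fcoef R N) N.+1 h t - h t)); have := integrableB mI (iT _ ih) ih.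
  - by apply: emeasurable_funD => //; exact: emeasurable_funD.
  - move=> t _; rewrite -!EFinD lee_fin trigconvB //.
    rewrite [X in _ <= _ + (_ + X)]distrC.
    have -> : trigconv (fcoef R N) N.+1 h t - h t =
      (trigconv (fcoef R N) N.+1 h t - trigconv (fcoef R N) N.+1 g t) +
      ((trigconv (fcoef R N) N.+1 g t - g t) + (g t - h t)) by ring.
    by apply: (le_trans (ler_normD _ _)); rewrite lerD2l ler_normD.
rewrite ge0_integralD //; last 2 first.
- by move=> t _; rewrite -EFinD lee_fin addr_ge0.
- exact: emeasurable_funD.
rewrite ge0_integralD //.
have -> : e = e / 3 + (e / 3 + e / 3) by lra.
rewrite !EFinD; apply: lteD; last exact: lteD.
exact: (le_lt_trans hc).
Qed.

(* For even h, convolution by the squared coefficients is the iterated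
   Fejer mean. *)
Lemma fejer_sq_L1_cvg (R : realType) (h : R -> R) (e : R) :
  lebesgue_measure.-integrable (@I01 R) (EFin \o h) -> even01 h -> 0 < e ->
  exists N0 : nat, forall N, (N0 <= N)%N ->
  (\int[lebesgue_measure]_(t in @I01 R)
     (`|trigconv (fun n => fcoef R N n ^+ 2)%R N.+1 h t - h t|)%:E < e%:E)%E.
Proof.
move=> ih eh e0; have mI := @measurable_I01 R.
have e2 : 0 < e / 2 by rewrite divr_gt0.
have [N0 h0] := fejer_L1_cvg ih e2.
exists N0 => N /h0 {}h0.
set T := trigconv (fcoef R N) N.+1.
have iT f (i : lebesgue_measure.-integrable (@I01 R) (EFin \o f)) : lebesgue_measure.-integrable (@I01 R) (EFin \o T f)
  := continuous_integrable01 (continuous_trigconv i).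
have TT t : trigconv (fun n => fcoef R N n ^+ 2) N.+1 h t = T (T h) t.
  have -> : T h = trigpoly (fun n => fcoef R N n * coscoef h n) N.+1.
    by apply/funext => s; exact: trigconv_even.
  rewrite /T trigconv_trigpoly trigconv_even //.
  by apply: eq_bigr => n _; rewrite expr2 mulrA.
have iD : lebesgue_measure.-integrable (@I01 R) (EFin \o (fun t => T h t - h t)).
  by have := integrableB mI (iT _ ih) ih.
have hc := fejer_contraction N iD.
(* T (T h) - h = T (T h - h) + (T h - h), and T is a contraction. *)
apply: (@le_lt_trans _ _ (\int[lebesgue_measure]_(t in @I01 R)
   ((`|T (fun t => T h t - h t)%R t|)%:E + (`|T h t - h t|)%:E))%E).
  apply: ge0_le_integral => //.
  - under eq_fun do rewrite TT.
    apply: (@measurable_norm_EFin _ (fun t => T (T h) t - h t)).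
    by have := integrableB mI (iT _ (iT _ ih)) ih.
  - by apply: emeasurable_funD; apply: measurable_norm_EFin => //; exact: iT.
  - move=> t _; rewrite -EFinD lee_fin TT.
    have -> : T (fun t => T h t - h t) t = T (T h) t - T h t by apply: trigconvB => //; exact: iT.
    by have := ler_normD (T (T h) t - T h t) (T h t - h t); rewrite addrA subrK.
rewrite ge0_integralD //; [|by apply: measurable_norm_EFin; exact: iT|exact: measurable_norm_EFin].
have -> : e = e / 2 + e / 2 by lra.
rewrite EFinD; apply: lteD => //.
exact: (le_lt_trans hc).
Qed.

(** * The approximate diagonal *)

Definition cplx (R : realType) (f : R -> R) : fn R := fun t => Complex (f t) 0.

Lemma cplxZ (R : realType) (c : R) (f : R -> R) :
  cplx (fun t => c * f t) = (fun t => c%:C%C * cplx f t).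
Proof.
apply/funext => t; rewrite /cplx.
by apply/eqP; rewrite eq_complex /= !mul0r !mulr0 subr0 addr0 !eqxx.
Qed.

Lemma normc_real (R : realType) (x : R) : Normc.normc (Complex x 0) = `|x|.
Proof. by rewrite /= expr0n /= addr0 sqrtr_sqr. Qed.

Lemma l1norm_cplx (R : realType) (f : R -> R) :
  l1norm (cplx f) = (\int[lebesgue_measure]_(t in @I01 R) (`|f t|)%:E)%E.
Proof. by apply: eq_integral => t _; rewrite normc_real. Qed.

Lemma l1norm_ge0 (R : realType) (f : fn R) : (0 <= l1norm f)%E.
Proof.
apply: integral_ge0 => t _; rewrite lee_fin.
by case: (f t) => x y; exact: sqrtr_ge0.
Qed.

Lemma l1norm0 (R : realType) : l1norm (fun _ : R => 0 : R[i]) = 0%E.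
Proof. by rewrite /l1norm integral0_eq // => t _; rewrite Normc.normc0. Qed.

Lemma ZL1_cplx (R : realType) (f : R -> R) : continuous f ->
  (forall x, f (Defs.frac (- x)) = f x) -> ZL1 (cplx f).
Proof.
move=> cf ef; split; last by apply: aeW => x _; rewrite /cplx ef.
split; first split => /=.
- by apply: measurable_funTS; exact: continuous_measurable_fun.
- exact: measurable_cst.
rewrite l1norm_cplx.
by have /integrableP[] := continuous_integrable01 cf.
Qed.

Lemma ZL1_trigpoly (R : realType) (c : nat -> R) (K : nat) : ZL1 (cplx (trigpoly c K)).
Proof.
apply: ZL1_cplx; first exact: continuous_trigpoly.
by move=> x; rewrite trigpoly_frac trigpolyN.
Qed.

Lemma ZL1_chiZ (R : realType) (c : R) (n : nat) : ZL1 (cplx (fun t => c * chi n t)).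
Proof. by rewrite trigpoly_monomial; exact: ZL1_trigpoly. Qed.

Lemma ZL1_chi (R : realType) (n : nat) : ZL1 (cplx (@chi R n)).
Proof.
apply: ZL1_cplx; first exact: continuous_chi.
by move=> x; rewrite chi_frac chiN.
Qed.

Lemma ZL1_0 (R : realType) : ZL1 (fun _ : R => 0 : R[i]).
Proof. exact: (@ZL1_cplx _ (fun=> 0) (fun=> cvg_cst _)). Qed.

(** Without sign changes the norm is the integral, which sees only the constant coefficient. *)
Lemma trigpoly_unit_mass (R : realType) (c : nat -> R) (K : nat) :
  (forall t, 0 <= trigpoly c K.+1 t) -> c 0 = 1 -> l1norm (cplx (trigpoly c K.+1)) = 1%E.
Proof.
move=> g0 c0; rewrite l1norm_cplx.
under eq_integral do rewrite ger0_norm //.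
have i := integrable_trigpoly c K.+1.
rewrite -[LHS]fineK; last by apply: (integrable_fin_num _ i); exact: measurable_I01.
congr EFin; rewrite -[RHS]c0 -(@Rintegral_trigpoly _ c K.+1 0) //.
by apply: eq_Rintegral => u _; rewrite mul0r cos0 mul1r.
Qed.

(** In F_N(t - s) + F_N(t + s) the sine parts cancel: the factor cos_n(s) on the coefficients
    symmetrises a translate and keeps it nonnegative. *)
Lemma fejer_average_ge0 (R : realType) (N : nat) (s t : R) :
  0 <= trigpoly (fun n => fcoef R N n * cos (n%:R * (2 * pi * s))) N.+1 t.
Proof.
have -> : trigpoly (fun n => fcoef R N n * cos (n%:R * (2 * pi * s))) N.+1 t =
  2^-1 * (fejer N (t - s) + fejer N (t + s)).
  rewrite /fejer /trigpoly -big_split mulr_sumr; apply: eq_bigr => n _.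
  by rewrite /chi !mulrBr !mulrDr cosB cosD /=; field.
by rewrite mulr_ge0 // addr_ge0 // fejer_ge0.
Qed.

(** * Bilinear forms and the bound on the truncated diagonal *)

Lemma bil0l (R : realType) (phi : fn R -> fn R -> R[i]) (g : fn R) :
  bil_unit_ball (@ZL1 R) (@l1norm R) phi -> ZL1 g -> phi (fun=> 0) g = 0.
Proof.
move=> [lin1 _ _] Zg; have := lin1 1 _ _ g (@ZL1_0 R) (@ZL1_0 R) Zg.
have -> : (fun t : R => 1 * 0 + 0 : R[i]) = (fun=> 0) by apply/funext => t; rewrite mul1r addr0.
by rewrite mul1r -[LHS]addr0 => /addrI <-.
Qed.

Lemma bil0r (R : realType) (phi : fn R -> fn R -> R[i]) (f : fn R) :
  bil_unit_ball (@ZL1 R) (@l1norm R) phi -> ZL1 f -> phi f (fun=> 0) = 0.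
Proof.
move=> [_ lin2 _] Zf; have := lin2 1 f _ _ Zf (@ZL1_0 R) (@ZL1_0 R).
have -> : (fun t : R => 1 * 0 + 0 : R[i]) = (fun=> 0) by apply/funext => t; rewrite mul1r addr0.
by rewrite mul1r -[LHS]addr0 => /addrI <-.
Qed.

Lemma bilZl (R : realType) (phi : fn R -> fn R -> R[i]) (z : R[i]) (f g : fn R) :
  bil_unit_ball (@ZL1 R) (@l1norm R) phi -> ZL1 f -> ZL1 g ->
  phi (fun t => z * f t) g = z * phi f g.
Proof.
move=> bphi Zf Zg; have [lin1 _ _] := bphi.
rewrite -[RHS]addr0 -(bil0l bphi Zg) -(lin1 z f _ g Zf (@ZL1_0 R) Zg).
by congr phi; apply/funext => t; rewrite addr0.
Qed.

Lemma bilZr (R : realType) (phi : fn R -> fn R -> R[i]) (z : R[i]) (f g : fn R) :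
  bil_unit_ball (@ZL1 R) (@l1norm R) phi -> ZL1 f -> ZL1 g ->
  phi f (fun t => z * g t) = z * phi f g.
Proof.
move=> bphi Zf Zg; have [_ lin2 _] := bphi.
rewrite -[RHS]addr0 -(bil0r bphi Zf) -(lin2 z f g _ Zf Zg (@ZL1_0 R)).
by congr phi; apply/funext => t; rewrite addr0.
Qed.

Lemma bil_sum (R : realType) (phi : fn R -> fn R -> R[i]) (c d : nat -> R) (K L : nat) :
  bil_unit_ball (@ZL1 R) (@l1norm R) phi ->
  phi (cplx (trigpoly c K)) (cplx (trigpoly d L)) =
  \sum_(n < K) \sum_(m < L) (c n * d m)%:C%C * phi (cplx (@chi R n)) (cplx (@chi R m)).
Proof.
move=> bphi; have [lin1 lin2 _] := bphi.
have tp0 (e : nat -> R) : cplx (trigpoly e 0) = (fun=> 0).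
  by apply/funext => t; rewrite /cplx /trigpoly big_ord0.
have tpS (e : nat -> R) k : cplx (trigpoly e k.+1) =
    (fun t => (e k)%:C%C * cplx (chi k) t + cplx (trigpoly e k) t).
  apply/funext => t; rewrite /cplx /trigpoly big_ord_recr /= addrC.
  by apply/eqP; rewrite eq_complex /= !mul0r !mulr0 subr0 !addr0 !eqxx.
elim: K => [|K IH]; first by rewrite big_ord0 tp0 (bil0l bphi) //; exact: ZL1_trigpoly.
rewrite tpS lin1; [|exact: ZL1_chi|exact: ZL1_trigpoly|exact: ZL1_trigpoly].
rewrite IH big_ord_recr /= addrC; congr (_ + _).
elim: L {IH} => [|L IH]; first by rewrite big_ord0 tp0 (bil0r bphi) ?mulr0 //; exact: ZL1_chi.
rewrite tpS lin2; [|exact: ZL1_chi|exact: ZL1_chi|exact: ZL1_trigpoly].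
by rewrite big_ord_recr /= -IH mulrDr addrC rmorphM /= mulrA.
Qed.

Lemma normc_sum (R : realType) (I : Type) (r : seq I) (P : pred I) (F : I -> R[i]) :
  Normc.normc (\sum_(i <- r | P i) F i) <= \sum_(i <- r | P i) Normc.normc (F i).
Proof.
elim/big_ind2 : _ => [|x a y b xa yb|//]; first by rewrite Normc.normc0.
by apply: (le_trans (le_normcD _ _)); exact: lerD.
Qed.

(* The truncated diagonal is twice the average over the M-th roots of unity of
   g_j (x) g_j, minus chi_0 (x) chi_0, where g_j is the mean of the translates of
   the Fejer kernel by j/M and -j/M; each g_j has norm 1. *)
Lemma diagonal_bound (R : realType) (phi : fn R -> fn R -> R[i]) (N : nat) :
  bil_unit_ball (@ZL1 R) (@l1norm R) phi ->
  Normc.normc (\sum_(n < N.+1) (fcoef R N n ^+ 2)%:C%C * phi (cplx (@chi R n)) (cplx (@chi R n))) <= 3.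
Proof.
move=> bphi; have [_ _ bd] := bphi.
(* Frequencies n, m up to N have n + m < M, so the average over M points is exact. *)
pose M := (N.+1 + N.+1)%N.
have M0 : M%:R != 0 :> R by rewrite pnatr_eq0.
pose g (j : nat) := trigpoly (fun n => fcoef R N n * cos (n%:R * (2 * pi * (j%:R / M%:R)))) N.+1.
have g1 j : l1norm (cplx (g j)) = 1%E.
  apply: trigpoly_unit_mass; first exact: fejer_average_ge0.
  by rewrite fcoef0 mul0r cos0 mulr1.
have chi1 : l1norm (cplx (@chi R 0)) = 1%E.
  have -> : @chi R 0 = trigpoly (fun=> 1) 1.
    by apply/funext => t; rewrite /trigpoly big_ord_recl big_ord0 addr0 mul1r.
  apply: trigpoly_unit_mass => // t.
  by rewrite /trigpoly big_ord_recl big_ord0 /chi /= mul0r cos0 !mul1r addr0.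
have b00 : Normc.normc (phi (cplx (@chi R 0)) (cplx (@chi R 0))) <= 1.
  by have := bd _ _ (@ZL1_chi R 0) (@ZL1_chi R 0); rewrite chi1 mule1 lee_fin.
have bj j : Normc.normc (phi (cplx (g j)) (cplx (g j))) <= 1.
  have Zg : ZL1 (cplx (g j)) by exact: ZL1_trigpoly.
  by have := bd _ _ Zg Zg; rewrite g1 mule1 lee_fin.
(* Discrete orthogonality in j removes all mixed terms. *)
have avg : \sum_(j < M) phi (cplx (g j)) (cplx (g j)) =
  \sum_(n < N.+1) (fcoef R N n ^+ 2 * (M%:R / wt R n))%:C%C * phi (cplx (@chi R n)) (cplx (@chi R n)).
  under eq_bigr do rewrite bil_sum //.
  rewrite exchange_big /=; apply: eq_bigr => n _.
  rewrite exchange_big /= (bigD1 n) //= [X in _ + X]big1 ?addr0 => [|m mn].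
  - rewrite -mulr_suml -rmorph_sum /=; congr (_%:C%C * _).
    under eq_bigr do rewrite mulrACA.
    by rewrite -mulr_sumr sum_cosMcos ?eqxx ?mul1r // /M -addSn leq_add // ltnW.
  - rewrite -mulr_suml -rmorph_sum /=.
    under eq_bigr do rewrite mulrACA.
    rewrite -mulr_sumr sum_cosMcos; last by rewrite /M -addSn leq_add // ltnW.
    suff -> : (n == m :> nat) = false by rewrite mul0r mulr0 mul0r.
    by apply: contra_neqF mn => /eqP nm; exact/val_inj.
(* The factor 2 / M turns M / [wt R n] into 1 for n > 0 but into 2 for n = 0, so the constant term
   is counted once too often. *)
have -> : \sum_(n < N.+1) (fcoef R N n ^+ 2)%:C%C * phi (cplx (@chi R n)) (cplx (@chi R n)) =
  (2 / M%:R)%:C%C * (\sum_(j < M) phi (cplx (g j)) (cplx (g j))) - phi (cplx (@chi R 0)) (cplx (@chi R 0)).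
  rewrite avg mulr_sumr [in RHS]big_ord_recl [in LHS]big_ord_recl.
  rewrite [RHS]addrAC; congr (_ + _).
    rewrite mulrA -rmorphM /= fcoef0 expr1n divr1 mul1r mul1r.
    have -> : 2 / M%:R * M%:R = 2 :> R by field.
    by rewrite rmorph_nat mulr_natl mulr2n addrK.
  apply: eq_bigr => i _; rewrite mulrA -rmorphM /=; congr (_%:C%C * _).
  by field.
apply: (le_trans (le_normcD _ _)); rewrite normcN Normc.normcM.
have -> : 3 = 2 + 1 :> R by lra.
apply: lerD => //.
have -> : Normc.normc (2 / M%:R)%:C%C = 2 / M%:R :> R.
  by rewrite normc_real ger0_norm // divr_ge0.
have : Normc.normc (\sum_(j < M) phi (cplx (g j)) (cplx (g j))) <= M%:R.
  apply: (le_trans (normc_sum _ _ _)); apply: (@le_trans _ _ (\sum_(j < M) 1)).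
    by apply: ler_sum => j _.
  by rewrite sumr_const card_ord.
move=> h; rewrite -{2}[2](@mulfVK _ M%:R) // ler_pM2l // divr_gt0 // ltr0n.
Qed.

(** * Complex functions and their Fourier coefficients *)

Definition re (R : realType) (a : fn R) : R -> R := fun t => complex.Re (a t).
Definition im (R : realType) (a : fn R) : R -> R := fun t => complex.Im (a t).

Lemma measurable_normc (R : realType) (a : fn R) : cmeasurable a ->
  measurable_fun (@I01 R) (fun t => (Normc.normc (a t))%:E).
Proof.
move=> [mr mi]; apply/measurable_EFinP.
have -> : (fun t => Normc.normc (a t)) = Num.sqrt \o (fun t => re a t ^+ 2 + im a t ^+ 2).
  by apply/funext => t; rewrite /re /im /=; case: (a t).
apply: (measurableT_comp (continuous_measurable_fun (@sqrt_continuous R))).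
by apply: measurable_funD; exact: measurable_funX.
Qed.

Lemma normc_ge_re (R : realType) (z : R[i]) : `|complex.Re z| <= Normc.normc z.
Proof. by case: z => x y /=; rewrite -sqrtr_sqr ler_wsqrtr // lerDl sqr_ge0. Qed.

Lemma normc_ge_im (R : realType) (z : R[i]) : `|complex.Im z| <= Normc.normc z.
Proof. by case: z => x y /=; rewrite -sqrtr_sqr ler_wsqrtr // lerDr sqr_ge0. Qed.

Lemma normc_le (R : realType) (z : R[i]) :
  Normc.normc z <= `|complex.Re z| + `|complex.Im z|.
Proof.
case: z => x y /=; rewrite -[leRHS]ger0_norm ?addr_ge0 // -sqrtr_sqr ler_wsqrtr //.
rewrite sqrrD !real_normK ?num_real // addrAC lerDl.
by rewrite mulrn_wge0 // mulr_ge0.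
Qed.

Lemma L1_integrable_re (R : realType) (a : fn R) : L1 a ->
  lebesgue_measure.-integrable (@I01 R) (EFin \o re a).
Proof.
move=> [ma fa]; have [mr mi] := ma; apply/integrableP; split; first exact/measurable_EFinP.
apply: le_lt_trans fa; apply: ge0_le_integral => //.
- exact: measurable_I01.
- by apply: measurableT_comp => //; exact/measurable_EFinP.
- exact: measurable_normc.
- by move=> t _; rewrite lee_fin normc_ge_re.
Qed.

Lemma L1_integrable_im (R : realType) (a : fn R) : L1 a ->
  lebesgue_measure.-integrable (@I01 R) (EFin \o im a).
Proof.
move=> [ma fa]; have [mr mi] := ma; apply/integrableP; split; first exact/measurable_EFinP.
apply: le_lt_trans fa; apply: ge0_le_integral => //.
- exact: measurable_I01.
- by apply: measurableT_comp => //; exact/measurable_EFinP.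
- exact: measurable_normc.
- by move=> t _; rewrite lee_fin normc_ge_im.
Qed.

Lemma even01_re (R : realType) (a : fn R) : inv_symmetric a -> even01 (re a).
Proof.
case=> N [mN N0 subN]; exists N; split => //.
by apply: subset_trans subN => x /= h h'; apply: h => Ix; rewrite /re h'.
Qed.

Lemma even01_im (R : realType) (a : fn R) : inv_symmetric a -> even01 (im a).
Proof.
case=> N [mN N0 subN]; exists N; split => //.
by apply: subset_trans subN => x /= h h'; apply: h => Ix; rewrite /im h'.
Qed.

Lemma conv_trigpolyl (R : realType) (c : nat -> R) (K : nat) (a : fn R) :
  Defs.conv (cplx (trigpoly c K)) a =
  (fun t => Complex (trigconv c K (re a) t) (trigconv c K (im a) t)).
Proof.
apply/funext => t; rewrite /Defs.conv /cint /trigconv; congr Complex.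
- apply: eq_Rintegral => u _; rewrite /cplx trigpoly_frac /re.
  by case: (a u) => x y /=; rewrite mul0r subr0.
- apply: eq_Rintegral => u _; rewrite /cplx trigpoly_frac /im.
  by case: (a u) => x y /=; rewrite mul0r addr0.
Qed.

(** The substitution u -> t - u on the circle exchanges the two factors, at every t and not only
    almost everywhere. *)
Lemma conv_trigpolyC (R : realType) (c : nat -> R) (K : nat) (a : fn R) : L1 a ->
  Defs.conv a (cplx (trigpoly c K)) = Defs.conv (cplx (trigpoly c K)) a.
Proof.
move=> La; rewrite conv_trigpolyl; apply/funext => t.
have ct : continuous (fun u => trigpoly c K (t - u)).
  by apply: continuous_subl; exact: continuous_trigpoly.
rewrite /Defs.conv /cint /trigconv; congr Complex.
- rewrite -(fracB_I01 t (integrable01_mull ct (L1_integrable_re La))).2.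
  apply: eq_Rintegral => u _; rewrite trigpoly_reflect /re /cplx.
  by case: (a _) => x y /=; rewrite mulr0 subr0 mulrC.
- rewrite -(fracB_I01 t (integrable01_mull ct (L1_integrable_im La))).2.
  apply: eq_Rintegral => u _; rewrite trigpoly_reflect /im /cplx.
  by case: (a _) => x y /=; rewrite mulr0 add0r mulrC.
Qed.

(** On even functions this is the usual Fourier coefficient, the cosine being the even part of the
    exponential. *)
Definition fouriercoef (R : realType) (a : fn R) (n : nat) : R[i] :=
  Complex (coscoef (re a) n) (coscoef (im a) n).

Lemma fouriercoef_chi (R : realType) (n : nat) : fouriercoef (cplx (@chi R n)) n = 1.
Proof.
rewrite /fouriercoef /coscoef /re /im /=; congr Complex; first by rewrite Rintegral_chi eqxx.
by under eq_Rintegral do rewrite mulr0; exact: Rintegral_cst01.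
Qed.

(** Evenness kills the sine coefficient, so the algebra acts on the line through chi_n by scalars;
    the exact commutation of the tensors rests on this. *)
Lemma conv_monomial (R : realType) (c : R) (n : nat) (a : fn R) : ZL1 a ->
  Defs.conv (cplx (fun t => c * chi n t)) a =
  (fun t => c%:C%C * fouriercoef a n * cplx (chi n) t).
Proof.
move=> [La ea]; rewrite trigpoly_monomial conv_trigpolyl; apply/funext => t.
rewrite (trigconv_even _ _ _ (L1_integrable_re La) (even01_re ea)).
rewrite (trigconv_even _ _ _ (L1_integrable_im La) (even01_im ea)).
have E (l : nat -> R) : trigpoly (fun k => c * (k == n)%:R * l k) n.+1 t = c * l n * chi n t.
  rewrite /trigpoly big_ord_recr /= eqxx mulr1 big1 ?add0r // => i _.
  by rewrite ltn_eqF // mulr0 !mul0r.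
by rewrite !E; apply/eqP; rewrite eq_complex /=; apply/andP; split; apply/eqP; ring.
Qed.

Lemma conv_monomialC (R : realType) (c : R) (n : nat) (a : fn R) : ZL1 a ->
  Defs.conv a (cplx (fun t => c * chi n t)) =
  (fun t => c%:C%C * fouriercoef a n * cplx (chi n) t).
Proof.
by move=> Za; rewrite -conv_monomial // trigpoly_monomial conv_trigpolyC //; case: Za.
Qed.

(** The squared coefficient sits in the first leg alone; its vanishing for n > N makes this infinite
    representation a finite sum. *)
Definition fejer_diag (R : realType) (N n : nat) : fn R * fn R :=
  (cplx (fun t => fcoef R N n ^+ 2 * chi n t), cplx (@chi R n)).

Definition fejer_mult (R : realType) (N : nat) : fn R :=
  cplx (trigpoly (fun n => fcoef R N n ^+ 2) N.+1).

(** * Verification of the conditions for an approximate diagonal *)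

Lemma sum_stable (V : nmodType) (v : nat -> V) (K L : nat) :
  (forall n, (K <= n)%N -> v n = 0) -> (K <= L)%N ->
  \sum_(n < L) v n = \sum_(n < K) v n.
Proof.
move=> v0; elim: L => [|L IH]; first by rewrite leqn0 => /eqP ->.
rewrite leq_eqVlt => /predU1P[-> //|]; rewrite ltnS => KL.
by rewrite big_ord_recr /= v0 // addr0 IH.
Qed.

(** Pairings are given as limits; this turns those of the Fejer tensors into finite sums. *)
Lemma csum_to_finite (R : realType) (u : nat -> R[i]) (z : R[i]) (K : nat) :
  (forall n, (K <= n)%N -> u n = 0) -> csum_to u z -> z = \sum_(n < K) u n.
Proof.
move=> u0 h; apply/eqP; rewrite -subr_eq0; apply/eqP/Normc.eq0_normc/eqP.
have n0 (x : R[i]) : 0 <= Normc.normc x by case: x => x y; exact: sqrtr_ge0.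
rewrite eq_le n0 andbT; apply/ler_addgt0Pr => e e0; rewrite add0r.
have [N0 hN] := h e e0.
have := hN (maxn N0 K) (leq_maxl _ _).
by rewrite (sum_stable u0) ?leq_maxr // => /ltW.
Qed.

Lemma tensor_rep_fejer_diag (R : realType) (N : nat) :
  tensor_rep (@ZL1 R) (@l1norm R) (fejer_diag R N).
Proof.
split=> [n|]; first by split; [exact: ZL1_chiZ|exact: ZL1_chi].
pose v n := fine (l1norm (fejer_diag R N n).1 * l1norm (fejer_diag R N n).2).
have vE n : (l1norm (fejer_diag R N n).1 * l1norm (fejer_diag R N n).2 = (v n)%:E)%E.
  rewrite /v fineK // fin_numM //; rewrite ge0_fin_numE ?l1norm_ge0 //.
    by case: (@ZL1_chiZ R (fcoef R N n ^+ 2) n) => -[].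
  by case: (@ZL1_chi R n) => -[].
have v_ge0 n : 0 <= v n by rewrite -lee_fin -vE mule_ge0 // l1norm_ge0.
have v0 n : (N.+1 <= n)%N -> v n = 0.
  move=> Nn; rewrite /v /fejer_diag /= cplxZ fcoef_ge // expr0n /=.
  have -> : (fun t : R => 0%:C%C * cplx (chi n) t) = (fun=> 0) by apply/funext => t; rewrite mul0r.
  by rewrite l1norm0 mul0e.
exists (\sum_(n < N.+1) v n) => L.
under eq_bigr do rewrite vE.
rewrite sumEFin lee_fin; have [NL|LN] := leqP N.+1 L; first by rewrite (sum_stable v0).
have mono : {homo (fun k => \sum_(n < k) v n) : a b / (a <= b)%N >-> a <= b}.
  by apply: homo_leq => // [a b c|k]; [exact: le_trans|rewrite big_ord_recr lerDl].
exact: mono (ltnW LN).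
Qed.

Lemma fejer_diag_bounded (R : realType) (N : nat) :
  pinorm_diff_le (@ZL1 R) (@l1norm R) (fejer_diag R N) (@zero_rep R) 3.
Proof.
move=> phi bphi z1 z2 h1 h2.
have p n : phi (fejer_diag R N n).1 (fejer_diag R N n).2 =
  (fcoef R N n ^+ 2)%:C%C * phi (cplx (@chi R n)) (cplx (@chi R n)).
  by rewrite /fejer_diag /= cplxZ bilZl //; exact: ZL1_chi.
rewrite (csum_to_finite (K := N.+1) _ h1); last first.
  by move=> n Nn; rewrite p fcoef_ge // expr0n mul0r.
rewrite (csum_to_finite (K := 0) _ h2) ?big_ord0 ?subr0; last first.
  by move=> n _; rewrite /zero_rep /= bil0l //; exact: ZL1_0.
by under eq_bigr do rewrite p; exact: diagonal_bound.
Qed.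

Lemma mult_to_fejer_mult (R : realType) (N : nat) :
  mult_to (@Defs.conv R) (@l1norm R) (fejer_diag R N) (@fejer_mult R N).
Proof.
(* As each chi_n is idempotent, the difference is identically zero once all N + 1 terms are
   present. *)
move=> e e0; exists N.+1 => L NL.
have -> : (fun t => @fejer_mult R N t - \sum_(n < L) Defs.conv (fejer_diag R N n).1 (fejer_diag R N n).2 t)
  = (fun=> 0).
  apply/funext => t.
  have c n : Defs.conv (fejer_diag R N n).1 (fejer_diag R N n).2 t =
      (fcoef R N n ^+ 2 * chi n t)%:C%C.
    rewrite conv_monomial; last exact: ZL1_chi.
    by rewrite fouriercoef_chi mulr1 [RHS]rmorphM.
  under eq_bigr do rewrite c.
  rewrite (@sum_stable _ (fun n => (fcoef R N n ^+ 2 * chi n t)%:C%C) N.+1) // => [|n Nn].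
    by rewrite /fejer_mult /cplx /trigpoly -rmorph_sum /= subrr.
  by rewrite fcoef_ge // expr0n mul0r.
by rewrite l1norm0 lte_fin.
Qed.

(** On either leg a acts on chi_n by the same scalar, which bilinearity takes out of the form, so
    both pairings are the same finite sum. *)
Lemma fejer_diag_commutes (R : realType) (N : nat) (a : fn R) (e : R) : ZL1 a -> 0 <= e ->
  pinorm_diff_le (@ZL1 R) (@l1norm R) (lact (@Defs.conv R) a (fejer_diag R N))
    (ract (@Defs.conv R) (fejer_diag R N) a) e.
Proof.
move=> Za e0 phi bphi z1 z2 h1 h2.
pose u n := (fcoef R N n ^+ 2)%:C%C * fouriercoef a n * phi (cplx (@chi R n)) (cplx (@chi R n)).
have u0 n : (N.+1 <= n)%N -> u n = 0.
  by move=> Nn; rewrite /u fcoef_ge // expr0n !mul0r.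
have p1 n : phi (lact (@Defs.conv R) a (fejer_diag R N) n).1 (lact (@Defs.conv R) a (fejer_diag R N) n).2 = u n.
  by rewrite /lact /fejer_diag /= conv_monomialC // bilZl //; exact: ZL1_chi.
have p2 n : phi (ract (@Defs.conv R) (fejer_diag R N) a n).1 (ract (@Defs.conv R) (fejer_diag R N) a n).2 = u n.
  have cc : Defs.conv (cplx (@chi R n)) a = (fun t => fouriercoef a n * cplx (@chi R n) t).
    have := conv_monomial 1 n Za.
    by rewrite rmorph1 mul1r => <-; congr Defs.conv; apply/funext => t; rewrite /cplx mul1r.
  rewrite /ract /fejer_diag /= cc bilZr //; [|exact: ZL1_chiZ|exact: ZL1_chi].
  by rewrite cplxZ bilZl //; [rewrite /u mulrCA mulrA|exact: ZL1_chi..].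
rewrite (csum_to_finite (K := N.+1) _ h1); last by move=> n Nn; rewrite p1 u0.
rewrite (csum_to_finite (K := N.+1) _ h2); last by move=> n Nn; rewrite p2 u0.
under eq_bigr do rewrite p1.
under [X in _ - X]eq_bigr do rewrite p2.
by rewrite subrr Normc.normc0.
Qed.

(** The kernel is real, so it acts separately on real and imaginary parts, each with an error below
    e / 2. *)
Lemma fejer_mult_approx_id (R : realType) (a : fn R) (e : R) : ZL1 a -> 0 < e ->
  exists N0 : nat, forall N, (N0 <= N)%N ->
  (l1norm (fsub (Defs.conv (@fejer_mult R N) a) a) < e%:E)%E.
Proof.
move=> [La ea] e0.
have mI := @measurable_I01 R.
have e2 : 0 < e / 2 by rewrite divr_gt0.
have ir := L1_integrable_re La; have ii := L1_integrable_im La.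
have [N1 h1] := fejer_sq_L1_cvg ir (even01_re ea) e2.
have [N2 h2] := fejer_sq_L1_cvg ii (even01_im ea) e2.
exists (maxn N1 N2) => N; rewrite geq_max => /andP[/h1 {}h1 /h2 {}h2].
set c := fun n => fcoef R N n ^+ 2 in h1 h2.
have iD f : lebesgue_measure.-integrable (@I01 R) (EFin \o f) ->
   measurable_fun (@I01 R) (fun t => trigconv c N.+1 f t - f t).
  move=> i; have := integrableB mI (continuous_integrable01 (continuous_trigconv (c := c) (K := N.+1) i)) i.
  by case/integrableP => /measurable_EFinP.
have nD f (i : lebesgue_measure.-integrable (@I01 R) (EFin \o f)) :
   measurable_fun (@I01 R) (fun t => (`|trigconv c N.+1 f t - f t|)%:E).
  by apply/measurable_EFinP; apply: measurableT_comp => //; exact: iD.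
rewrite /fejer_mult conv_trigpolyl -/c.
set d := fsub _ _.
have rd t : complex.Re (d t) = trigconv c N.+1 (re a) t - re a t.
  by rewrite /d /fsub /re; case: (a t).
have id t : complex.Im (d t) = trigconv c N.+1 (im a) t - im a t.
  by rewrite /d /fsub /im; case: (a t).
apply: (@le_lt_trans _ _ (\int[lebesgue_measure]_(t in @I01 R)
   ((`|trigconv c N.+1 (re a) t - re a t|)%:E + (`|trigconv c N.+1 (im a) t - im a t|)%:E))%E).
  apply: ge0_le_integral => //.
  - move=> t _; rewrite lee_fin; exact: le_trans (normc_ge_re _).
  - apply: measurable_normc; split; first by under eq_fun do rewrite rd; exact: iD.
    by under eq_fun do rewrite id; exact: iD.
  - by apply: emeasurable_funD; exact: nD.
  - by move=> t _; rewrite -EFinD lee_fin -rd -id normc_le.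
rewrite ge0_integralD //; [|exact: nD|exact: nD].
have -> : e = e / 2 + e / 2 by lra.
by rewrite EFinD; exact: lteD.
Qed.

Theorem theorem1p13 (R : realType) : ZL1T_amenable R.
Proof.
exists nat, (fun i j => (i <= j)%N), (fejer_diag R), (@fejer_mult R), 3; split.
- split; [exact: (inhabits 0)|exact: leqnn|by move=> i j k; exact: leq_trans|].
  by move=> i j; exists (maxn i j); rewrite leq_maxl leq_maxr.
- exact: tensor_rep_fejer_diag.
- exact: fejer_diag_bounded.
- by move=> N; split; [exact: ZL1_trigpoly|exact: mult_to_fejer_mult].
move=> a Za e e0; have [N0 h] := fejer_mult_approx_id Za e0.
exists N0 => N N0N; split; first exact: h.
  by rewrite /fejer_mult conv_trigpolyC; [exact: h|case: Za].
exact: fejer_diag_commutes (ltW e0).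
Qed.
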